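(* Let $H$ be a real separable Hilbert space, $d\ge 1$, and let $\rho:\mathbb{R}^d\to H$ be a function. Let $\zeta(u)$, $u\in\mathbb{R}^d$, be a centered Gaussian random field with covariance $$E\,\zeta(u)\zeta(v)=(\rho(u),\rho(v)),\qquad u,v\in\mathbb{R}^d .$$ Suppose that: 1) $\zeta$ has a continuous modification on $\mathbb{R}^d$; 2) with probability one there exists the (finite) limit $\zeta(\infty):=\lim_{\|u\|\to+\infty}\zeta(u)$, where $\zeta$ denotes the continuous modification. Then there exists an orthonormal basis $\{e_m,\ m\ge1\}$ of $H$ such that $$\sum_{m=1}^{\infty}\sup_{u\in\mathbb{R}^d}(\rho(u),e_m)^2<+\infty .$$
   Context: $(\cdot,\cdot)$ denotes the scalar product of $H$. Orthonormal bases of $H$ are indexed by $m\ge1$ (by $m\le\dim H$ if $H$ is finite-dimensional). A modification of $\zeta$ is a random field $\tilde\zeta$ on the same probability space with $P\{\tilde\zeta(u)=\zeta(u)\}=1$ for every $u\in\mathbb{R}^d$. *)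

(* Defs.v *)
From HB Require Import structures.
From mathcomp Require Import all_boot all_order all_algebra.
From mathcomp Require Import all_classical all_reals all_analysis.

Set Implicit Arguments.
Unset Strict Implicit.
Unset Printing Implicit Defensive.

Import Order.TTheory GRing.Theory Num.Theory.
Import numFieldNormedType.Exports.

Local Open Scope classical_set_scope.
Local Open Scope ring_scope.

Section Hilbert.
Context (R : realType) (H : completeNormedModType R).

(* A real Hilbert space is a complete normed space H together with a positive
   definite symmetric bilinear form which induces its norm. *)
Definition induces_norm (dot : {dot H for idfun}) : Prop :=
  forall x : H, `|x| = Num.sqrt (dot x x).

Definition separable : Prop := exists2 D : set H, countable D & dense D.

(* The index set I is all of nat, or {0, ..., n - 1} when dim H = n is finite;
   indices start at 0, and the values of e outside I are irrelevant. *)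
Definition orthonormal_basis (dot : {dot H for idfun})
    (I : set nat) (e : nat -> H) : Prop :=
  [/\ I = [set: nat] \/ (exists n : nat, I = `I_n),
      forall i j, I i -> I j -> dot (e i) (e j) = (i == j)%:R &
      dense [set x : H | exists (n : nat) (c : nat -> R),
               x = \sum_(0 <= i < n | i \in I) c i *: e i]].

End Hilbert.

Section Field.
Context (R : realType) (d : nat).

Definition euclidean_norm (u : 'rV[R]_d) : R := Num.sqrt (\sum_i u ord0 i ^+ 2).

Definition norm_infty : set_system 'rV[R]_d :=
  filter_from [set: R] (fun M => [set u | M < euclidean_norm u]).

Context (disp : measure_display) (T : measurableType disp).
Context (P : probability T R).

(* The library's normal_prob m s is a uniform law when s = 0; a Gaussian law
   of variance 0 is the Dirac mass at m. *)
Definition gaussian_law (m s : R) (A : set R) : \bar R :=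
  if s == 0 then dirac m A else normal_prob m s A.

Definition gaussian_variable (X : T -> R) : Prop :=
  exists m s : R, forall A : set R, measurable A ->
    P (X @^-1` A) = gaussian_law m s A.

(* All finite linear combinations are Gaussian, i.e. the finite-dimensional
   distributions are (possibly degenerate) Gaussian vectors. *)
Definition gaussian_field (X : 'rV[R]_d -> {RV P >-> R}) : Prop :=
  forall (n : nat) (u : 'I_n -> 'rV[R]_d) (a : 'I_n -> R),
    gaussian_variable (fun w => \sum_(i < n) a i * X (u i) w).

Definition centered_field (X : 'rV[R]_d -> {RV P >-> R}) : Prop :=
  forall u, 'E_P[X u]%E = 0%E.

Definition modification (X Y : 'rV[R]_d -> {RV P >-> R}) : Prop :=
  forall u, P [set w | Y u w = X u w] = 1%E.

Definition continuous_paths (X : 'rV[R]_d -> {RV P >-> R}) : Prop :=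
  forall w, continuous (fun u => X u w).

End Field.

(* Main.v *)
Require Import Defs.
From HB Require Import structures.
From mathcomp Require Import all_boot all_order all_algebra.
From mathcomp Require Import all_classical all_reals all_analysis.
From mathcomp Require Import measurable_realfun.
From mathcomp Require Import ring lra zify.

Set Implicit Arguments.
Unset Strict Implicit.
Unset Printing Implicit Defensive.

Import Order.TTheory GRing.Theory Num.Theory.
Import numFieldNormedType.Exports.

Local Open Scope classical_set_scope.
Local Open Scope ring_scope.

(* Let [e_j] be a Gram-Schmidt basis of the closed span of [rho], put
   [phi_j u = (rho u, e_j)] and let [g_j] be the corresponding independent
   standard Gaussian combinations of values of [zeta].  Flipping the signs of
   finitely many [g_j] does not change the law of the field; since a signed block
   [sum_j +-g_j phi_j] is half a difference of two such reflected fields, its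
   oscillation off a finite net of the one-point compactification of R^d is small
   with high probability, while on the net itself it is small in L^2 for blocks
   that start far enough, by Bessel's inequality.  The contraction principle and
   Kahane's inequality turn smallness in probability into a small value of
   [E sup_u |sum_j eps_j phi_j u|^2] for Rademacher signs [eps_j].  Rotating a
   block of length [2^a] by a Walsh-Hadamard matrix with randomly signed columns
   then produces orthonormal vectors [e'_k] of the same span with
   [sum_k sup_u (rho u, e'_k)^2 <= E sup_u |sum_j eps_j phi_j u|^2] for a suitable
   choice of the signs, and these bounds can be made summable over the blocks.

   Finite-dimensional laws are compared without characteristic functions of
   vectors: the integrals of the cosines [cos (sum_i a_i X_i)] depend only on
   one-dimensional Gaussian laws, and they determine the integrals of even
   trigonometric polynomials, which approximate indicators of boxes. *)

(** * Averages over the discrete cube *)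

(** A block bound [E sup_u |sum_j eps_j phi_j u|^2] controls only the largest [sup_u (phi_j u)^2],
    not the sum of these suprema. The rotation repairs this: it spreads each vector evenly over all
    those of the block, so that summing over the [2 ^ a] rows costs exactly the factor that the
    normalization [2^(-a/2)] wins back. Suprema over R^d are not formed before the end. Every
    probabilistic estimate concerns an arbitrary finite family of points, with constants independent
    of their number, so that finite-dimensional laws suffice. The price is paid in the choice of the
    signs: the points at which the various sign patterns fail have to be gathered into one finite
    family before averaging. The first block cannot start far out and only receives some finite
    bound, which is enough for summability. If the span is finite-dimensional, there are no
    infinitely many full blocks, and blocks of length 1 are used instead. *)

Section Cube.
Context (R : realFieldType).
Implicit Types (f g : seq bool -> R) (n : nat).

Definition sg (b : bool) : R := if b then 1 else -1.

Fixpoint avg n f : R :=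
  if n is n'.+1 then
    (avg n' (fun s => f (true :: s)) + avg n' (fun s => f (false :: s))) / 2
  else f [::].

Lemma eq_avg n f g : (forall s, size s = n -> f s = g s) -> avg n f = avg n g.
Proof.
elim: n f g => [|n IH] f g fg /=; first exact: fg.
by congr ((_ + _) / _); apply: IH => s ss; apply: fg => /=; rewrite ss.
Qed.

Lemma avgD n f g : avg n (fun s => f s + g s) = avg n f + avg n g.
Proof. by elim: n f g => [|n IH] f g //=; rewrite !IH; field. Qed.

Lemma avgZ n (a : R) f : avg n (fun s => a * f s) = a * avg n f.
Proof. by elim: n f => [|n IH] f //=; rewrite !IH; field. Qed.

Lemma avgN n f : avg n (fun s => - f s) = - avg n f.
Proof.
by rewrite -mulN1r -avgZ; apply: eq_avg => s _; rewrite mulN1r.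
Qed.

Lemma avgB n f g : avg n (fun s => f s - g s) = avg n f - avg n g.
Proof. by rewrite avgD avgN. Qed.

Lemma avg_cst n (a : R) : avg n (fun=> a) = a.
Proof. by elim: n => [|n IH] //=; rewrite IH; field. Qed.

Lemma ler_avg n f g : (forall s, size s = n -> f s <= g s) -> avg n f <= avg n g.
Proof.
elim: n f g => [|n IH] f g fg /=; first exact: fg.
rewrite ler_pM2r ?invr_gt0//.
by apply: lerD; apply: IH => s ss; apply: fg => /=; rewrite ss.
Qed.

Lemma avg_ge0 n f : (forall s, size s = n -> 0 <= f s) -> 0 <= avg n f.
Proof. by move=> f0; rewrite -(avg_cst n 0); exact: ler_avg. Qed.

Lemma avg_sum (I : Type) (r : seq I) n (f : I -> seq bool -> R) :
  avg n (fun s => \sum_(i <- r) f i s) = \sum_(i <- r) avg n (f i).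
Proof.
elim: r => [|i r IH].
  by rewrite big_nil -[RHS](avg_cst n); apply: eq_avg => s _; rewrite big_nil.
rewrite big_cons -IH -avgD; apply: eq_avg => s _; exact: big_cons.
Qed.

Lemma avg_attained n f : exists2 s, size s = n & f s <= avg n f.
Proof.
elim: n f => [|n IH] f /=; first by exists [::].
have [s1 z1 h1] := IH (fun s => f (true :: s)).
have [s0 z0 h0] := IH (fun s => f (false :: s)).
have [le|/ltW le] := leP (avg n (fun s => f (true :: s)))
                         (avg n (fun s => f (false :: s))).
- by exists (true :: s1); rewrite /= ?z1//; lra.
- by exists (false :: s0); rewrite /= ?z0//; lra.
Qed.

(* [1/4] times the sum over the coordinates [i] of the average of
   [(f - f o flip_i)^2]. *)
Fixpoint dirichlet n f : R :=
  if n is n'.+1 then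
    (dirichlet n' (fun s => f (true :: s)) +
     dirichlet n' (fun s => f (false :: s))) / 2 +
    avg n' (fun s => (f (true :: s) - f (false :: s)) ^+ 2) / 4
  else 0.

Lemma eq_dirichlet n f g : f =1 g -> dirichlet n f = dirichlet n g.
Proof.
elim: n f g => [|n IH] f g fg //=; congr ((_ + _) / _ + _ / _).
- by apply: IH => s; exact: fg.
- by apply: IH => s; exact: fg.
- by apply: eq_avg => s _; rewrite !fg.
Qed.

(** [dirichlet] is a quadratic form. The identity is applied to the even and odd parts in the first
    coordinate, whose sum and difference are the two halves of [f]. *)
Lemma dirichlet_parallelogram n f g :
  dirichlet n (fun s => f s + g s) + dirichlet n (fun s => f s - g s) =
  2 * (dirichlet n f + dirichlet n g).
Proof.
elim: n f g => [|n IH] f g /=; first by rewrite !addr0 mulr0.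
have h1 := IH (fun s => f (true :: s)) (fun s => g (true :: s)).
have h0 := IH (fun s => f (false :: s)) (fun s => g (false :: s)).
have h : avg n (fun s => (f (true :: s) + g (true :: s) -
            (f (false :: s) + g (false :: s))) ^+ 2) +
         avg n (fun s => (f (true :: s) - g (true :: s) -
            (f (false :: s) - g (false :: s))) ^+ 2) =
   2 * (avg n (fun s => (f (true :: s) - f (false :: s)) ^+ 2) +
        avg n (fun s => (g (true :: s) - g (false :: s)) ^+ 2)).
  rewrite -!avgD -avgZ; apply: eq_avg => s _; ring.
move: h1 h0 h; lra.
Qed.

Definition evenp f s := (f (true :: s) + f (false :: s)) / 2.
Definition oddp f s := (f (true :: s) - f (false :: s)) / 2.

Lemma avgS_evenp n f : avg n.+1 f = avg n (evenp f).
Proof.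
rewrite /= -avgD mulrC -avgZ; apply: eq_avg => s _.
by rewrite /evenp mulrC.
Qed.

Lemma avgS_sqr n f :
  avg n.+1 (fun s => f s ^+ 2) =
  avg n (fun s => evenp f s ^+ 2) + avg n (fun s => oddp f s ^+ 2).
Proof.
rewrite /= -!avgD mulrC -avgZ; apply: eq_avg => s _.
by rewrite /evenp /oddp; field.
Qed.

Lemma dirichletS n f :
  dirichlet n.+1 f = dirichlet n (evenp f) + dirichlet n (oddp f) +
    avg n (fun s => oddp f s ^+ 2).
Proof.
have := dirichlet_parallelogram n (evenp f) (oddp f).
rewrite (@eq_dirichlet _ (fun s => evenp f s + oddp f s)
                         (fun s => f (true :: s))); last first.
  by move=> s; rewrite /evenp /oddp; field.
rewrite (@eq_dirichlet _ (fun s => evenp f s - oddp f s)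
                         (fun s => f (false :: s))); last first.
  by move=> s; rewrite /evenp /oddp; field.
have -> : avg n (fun s => oddp f s ^+ 2) =
          avg n (fun s => (f (true :: s) - f (false :: s)) ^+ 2) / 4.
  by rewrite mulrC -avgZ; apply: eq_avg => s _; rewrite /oddp; field.
rewrite /=; lra.
Qed.

(** In the Walsh expansion [dirichlet] weights each squared coefficient by its degree, which is at
    least 1 off the constant; the induction peels one coordinate at a time. *)
Lemma poincare n f : avg n (fun s => f s ^+ 2) - avg n f ^+ 2 <= dirichlet n f.
Proof.
elim: n f => [|n IH] f; first by rewrite /= subrr.
rewrite avgS_sqr avgS_evenp dirichletS.
have := IH (evenp f); have := IH (oddp f).
have : 0 <= dirichlet n (oddp f).
  elim: n (oddp f) {IH} => [|n IH] g //=.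
  have := IH (fun s => g (true :: s)); have := IH (fun s => g (false :: s)).
  have : 0 <= avg n (fun s => (g (true :: s) - g (false :: s)) ^+ 2).
    by apply: avg_ge0 => s _; exact: sqr_ge0.
  lra.
lra.
Qed.

(* The sum of the squares of the first-order Walsh coefficients. *)
Fixpoint walsh1 n f : R :=
  if n is n'.+1 then walsh1 n' (evenp f) + avg n' (oddp f) ^+ 2 else 0.

(** Degrees are at least 2 apart from the constant and first-order terms, and the latter enter on
    the left with weight [2 - 1]. *)
Lemma poincare2 n f :
  2 * (avg n (fun s => f s ^+ 2) - avg n f ^+ 2) - walsh1 n f <= dirichlet n f.
Proof.
elim: n f => [|n IH] f; first by rewrite /= subrr mulr0 subr0.
rewrite avgS_sqr avgS_evenp dirichletS /=.
have := IH (evenp f); have := poincare n (oddp f); lra.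
Qed.

Lemma avg_neg n f : avg n (fun s => f (map negb s)) = avg n f.
Proof.
elim: n f => [|n IH] f //=.
by rewrite (IH (fun s => f (false :: s))) (IH (fun s => f (true :: s))) addrC.
Qed.

(** Antipodal symmetry kills the odd degrees: [oddp f] changes sign under [negb], so its average is
    its own opposite. *)
Lemma walsh1_even n f : (forall s, size s = n -> f (map negb s) = f s) ->
  walsh1 n f = 0.
Proof.
elim: n f => [|n IH] f fe //=.
have {}fe b s : size s = n -> f (b :: map negb s) = f (~~ b :: s).
  by move=> ss; rewrite -[RHS]fe /= ?ss ?negbK.
rewrite IH; last first.
  by move=> s ss; rewrite /evenp !fe // addrC.
have : avg n (oddp f) = - avg n (oddp f).
  rewrite -avgN -(avg_neg _ (fun s => - oddp f s)); apply: eq_avg => s ss.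
  by rewrite /oddp !fe // -mulNr opprB.
move=> e; have -> : avg n (oddp f) = 0 by lra.
by rewrite expr0n addr0.
Qed.

(** The adjacency operator of the discrete cube. *)
Fixpoint flips n f (s : seq bool) : R :=
  if n is n'.+1 then
    if s is b :: s' then f (~~ b :: s') + flips n' (fun t => f (b :: t)) s'
    else 0
  else 0.

Lemma eq_flips n f g s : f =1 g -> flips n f s = flips n g s.
Proof.
elim: n f g s => [|n IH] f g [|b s] fg //=.
by rewrite fg; congr (_ + _); apply: IH => t; exact: fg.
Qed.

(** The Dirichlet form belongs to half the graph Laplacian of the cube. *)
Lemma dirichlet_flips n f :
  dirichlet n f = (n%:R * avg n (fun s => f s ^+ 2) -
                   avg n (fun s => f s * flips n f s)) / 2.
Proof.
elim: n f => [|n IH] f; first by rewrite /= mul0r mulr0 subrr mul0r.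
rewrite /= !IH.
have -> : avg n (fun s => f (true :: s) *
      (f (false :: s) + flips n (fun t => f (true :: t)) s)) =
  avg n (fun s => f (true :: s) * f (false :: s)) +
  avg n (fun s => f (true :: s) * flips n (fun t => f (true :: t)) s).
  by rewrite -avgD; apply: eq_avg => s _; rewrite mulrDr.
have -> : avg n (fun s => f (false :: s) *
      (f (true :: s) + flips n (fun t => f (false :: t)) s)) =
  avg n (fun s => f (true :: s) * f (false :: s)) +
  avg n (fun s => f (false :: s) * flips n (fun t => f (false :: t)) s).
  by rewrite -avgD; apply: eq_avg => s _; rewrite mulrDr [X in X + _]mulrC.
have -> : avg n (fun s => (f (true :: s) - f (false :: s)) ^+ 2) =
  avg n (fun s => f (true :: s) ^+ 2) + avg n (fun s => f (false :: s) ^+ 2)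
  - 2 * avg n (fun s => f (true :: s) * f (false :: s)).
  by rewrite -avgZ -avgD -avgB; apply: eq_avg => s _; ring.
by rewrite -[n.+1]addn1 natrD; field.
Qed.

End Cube.

(** * Rademacher sums *)

Section Rademacher.
Context (R : realFieldType) (V : lmodType R) (q : V -> R).
Hypothesis qD : forall x y, q (x + y) <= q x + q y.
Hypothesis qZ : forall a x, q (a *: x) = `|a| * q x.
Implicit Types (x : nat -> V) (v : V).

Definition radsum n x (s : seq bool) : V :=
  \sum_(j < n) sg R (nth false s j) *: x j.

Lemma radS n x b s :
  radsum n.+1 x (b :: s) = sg R b *: x 0%N + radsum n (fun j => x j.+1) s.
Proof. by rewrite /radsum big_ord_recl. Qed.

Lemma sg_negb b : sg R (~~ b) = - sg R b.
Proof. by case: b; rewrite /sg ?opprK. Qed.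

Lemma normr_sgb b : `|sg R b| = 1.
Proof. by case: b; rewrite /sg ?normrN normr1. Qed.

Let q0 : q 0 = 0.
Proof. by rewrite -(scale0r (0 : V)) qZ normr0 mul0r. Qed.

Let qN v : q (- v) = q v.
Proof. by rewrite -scaleN1r qZ normrN normr1 mul1r. Qed.

Let q_ge0 v : 0 <= q v.
Proof. by have := qD v (- v); rewrite subrr q0 qN; lra. Qed.

Let qZ_ge (a : R) v : a * q v <= q (a *: v).
Proof. by rewrite qZ ler_wpM2r// ler_norm. Qed.

Lemma rad_neg n x s : size s = n -> radsum n x (map negb s) = - radsum n x s.
Proof.
move=> <-; rewrite /radsum -sumrN; apply: eq_bigr => j _.
by rewrite (nth_map false)// sg_negb scaleNr.
Qed.

(** Among the [n] neighbours of [s] each sign is reversed exactly once, so the sums add up to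
    [n - 2] copies of the one at [s]; the triangle inequality does the rest. The shift [v] absorbs
    the first coordinate in the induction. *)
Lemma flips_rad n x v s : size s = n ->
  q (n%:R *: v + (n%:R - 2) *: radsum n x s) <=
  flips n (fun t => q (v + radsum n x t)) s.
Proof.
elim: n x v s => [|n IH] x v [|b s] //=.
  by move=> _; rewrite scale0r add0r /radsum big_ord0 scaler0 q0.
case=> ss; rewrite !radS sg_negb.
rewrite (@eq_flips _ _ _
  (fun t => q ((v + sg R b *: x 0%N) + radsum n (fun j => x j.+1) t))); last first.
  by move=> t; rewrite radS addrA.
apply: le_trans (lerD (lexx _) (IH _ _ _ ss)).
apply: le_trans (qD _ _); rewrite le_eqVlt; apply/orP; left; apply/eqP.
congr q; set r := radsum n _ _; rewrite -[n.+1]addn1 natrD.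
set w := sg R b *: x 0%N; rewrite scaleNr -/w.
have e1 : 1 *: v + n%:R *: v = n%:R *: v + v by rewrite scale1r addrC.
rewrite !scalerDr [(n%:R + 1) *: v]scalerDl scale1r.
have -> : (n%:R + 1 - 2) *: w = n%:R *: w - w.
  by rewrite -{3}[w]scale1r -scalerBl; congr (_ *: _); ring.
have -> : (n%:R + 1 - 2) *: r = r + (n%:R - 2) *: r.
  by rewrite -{2}[r]scale1r -scalerDl; congr (_ *: _); ring.
by rewrite (AC (2*(2*2)) ((2*(4*5))*((1*3)*6))).
Qed.

(* Latala and Oleszkiewicz: the flips inequality bounds the Dirichlet form of
   [f] by [E f^2], while [f] is even and hence has spectral gap 2. *)
Lemma kahane n x :
  avg n (fun s => q (radsum n x s) ^+ 2) <= 2 * avg n (fun s => q (radsum n x s)) ^+ 2.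
Proof.
set f := fun s => q (radsum n x s).
have := poincare2 n f.
rewrite dirichlet_flips walsh1_even; last first.
  by move=> s ss; rewrite /f rad_neg// qN.
have : (n%:R - 2) * avg n (fun s => f s ^+ 2) <=
       avg n (fun s => f s * flips n f s).
  rewrite -avgZ; apply: ler_avg => s ss.
  rewrite expr2 mulrCA ler_wpM2l ?/f ?q_ge0//.
  apply: le_trans (qZ_ge _ _) _.
  have := flips_rad x 0 ss; rewrite scaler0 add0r => /le_trans; apply.
  by rewrite (@eq_flips _ _ _ f)// => t; rewrite add0r.
rewrite subr0 -/f.
move: (avg n (fun s => f s ^+ 2)) (avg n (fun s => f s * _)) => A B.
lra.
Qed.

(** Where [f > K], use [f <= m + f ^+ 2 / (4 * m)]. With [E f ^+ 2 <= 2 * m ^+ 2] from [kahane],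
    averaging gives [m <= K + m / 2 + m / 8], that is [m <= 8 * K / 3]. *)
Lemma rademacher_L0_L1 n x (K : R) : 0 <= K ->
  avg n (fun s => (K < q (radsum n x s))%R%:R : R) <= 1 / 8 ->
  avg n (fun s => q (radsum n x s)) <= 3 * K.
Proof.
set f := fun s => q (radsum n x s); move=> K0 fK.
have [m mE] : {m | m = avg n f} by exists (avg n f).
rewrite -mE; have m0 : 0 <= m by rewrite mE; apply: avg_ge0 => s _; exact: q_ge0.
have [->|mN] := eqVneq m 0; first by rewrite mulr_ge0.
have {mN}m0 : 0 < m by rewrite lt_neqAle eq_sym mN.
have : m <= K + (1 / (4 * m) * avg n (fun s => f s ^+ 2) +
            m * avg n (fun s => (K < f s)%R%:R : R)).
  rewrite {1}mE -[X in _ <= X + _](avg_cst n) -!avgZ -!avgD; apply: ler_avg => s _ /=.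
  have [Kf|Kf] := ltP K (f s).
    rewrite (_ : true%:R = 1 :> R)// mulr1.
    have : 0 <= (f s - 2 * m) ^+ 2 / (4 * m).
      by rewrite divr_ge0 ?sqr_ge0// mulr_ge0// ltW.
    have -> : (f s - 2 * m) ^+ 2 / (4 * m) =
      1 / (4 * m) * f s ^+ 2 + m - f s by field; rewrite gt_eqF.
    lra.
  rewrite (_ : false%:R = 0 :> R)// mulr0 addr0; have : 0 <= 1 / (4 * m) * f s ^+ 2.
    by rewrite mulr_ge0 ?sqr_ge0// divr_ge0// mulr_ge0// ltW.
  lra.
have h2 := kahane n x; rewrite -/f -mE in h2.
have : 1 / (4 * m) * avg n (fun s => f s ^+ 2) <= m / 2.
  have -> : m / 2 = 1 / (4 * m) * (2 * m ^+ 2) by field; rewrite gt_eqF.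
  by rewrite ler_wpM2l// divr_ge0// mulr_ge0// ltW.
have : m * avg n (fun s => (K < f s)%R%:R : R) <= m * (1 / 8).
  by rewrite ler_wpM2l// ltW.
lra.
Qed.

(** Contraction principle: [t * eps] is the convex combination of [eps] and [- eps] with weights
    [(1 + t) / 2] and [(1 - t) / 2]. Coordinates are treated one at a time, [v] holding those
    already fixed. *)
Lemma avg_rad_scale n x v (t : nat -> R) : (forall j, 0 <= t j <= 1) ->
  avg n (fun s => q (v + radsum n (fun j => t j *: x j) s)) <=
  avg n (fun s => q (v + radsum n x s)).
Proof.
elim: n x v t => [|n IH] x v t t01.
  by rewrite /= /radsum !big_ord0.
have h b w : avg n (fun s => q (w + sg R b *: x 0%N +
                              radsum n (fun j => t j.+1 *: x j.+1) s)) <=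
             avg n (fun s => q (w + sg R b *: x 0%N + radsum n (fun j => x j.+1) s)).
  exact: IH.
have /andP[t0 t1] := t01 0%N.
have hb b : avg n (fun s => q (v + radsum n.+1 (fun j => t j *: x j) (b :: s))) <=
  (1 + t 0%N) / 2 * avg n (fun s => q (v + radsum n.+1 x (b :: s))) +
  (1 - t 0%N) / 2 * avg n (fun s => q (v + radsum n.+1 x (~~ b :: s))).
  have : avg n (fun s => q (v + radsum n.+1 (fun j => t j *: x j) (b :: s))) <=
    (1 + t 0%N) / 2 * avg n (fun s => q (v + sg R b *: x 0%N +
                              radsum n (fun j => t j.+1 *: x j.+1) s)) +
    (1 - t 0%N) / 2 * avg n (fun s => q (v + sg R (~~ b) *: x 0%N +
                              radsum n (fun j => t j.+1 *: x j.+1) s)).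
    rewrite -!avgZ -avgD; apply: ler_avg => s _; rewrite radS addrA.
    have <- : q (((1 + t 0%N) / 2) *: (v + sg R b *: x 0%N +
        radsum n (fun j => t j.+1 *: x j.+1) s)) =
        (1 + t 0%N) / 2 * q (v + sg R b *: x 0%N +
        radsum n (fun j => t j.+1 *: x j.+1) s).
      by rewrite qZ ger0_norm//; lra.
    have <- : q (((1 - t 0%N) / 2) *: (v + sg R (~~ b) *: x 0%N +
        radsum n (fun j => t j.+1 *: x j.+1) s)) =
        (1 - t 0%N) / 2 * q (v + sg R (~~ b) *: x 0%N +
        radsum n (fun j => t j.+1 *: x j.+1) s).
      by rewrite qZ ger0_norm//; lra.
    apply: le_trans (qD _ _); rewrite le_eqVlt; apply/orP; left; apply/eqP.
    congr q; rewrite sg_negb !scalerDr addrACA.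
    set al := (1 + t 0%N) / 2; set be := (1 - t 0%N) / 2.
    have ab1 : al + be = 1 by rewrite /al /be; field.
    have abt : al - be = t 0%N by rewrite /al /be; field.
    rewrite [X in _ = X + _]addrACA -!(scalerDl _ al be) ab1 !scale1r !scalerA.
    by rewrite -scalerDl -abt; congr (_ + _ *: _ + _); ring.
  have h2 c : avg n (fun s => q (v + sg R c *: x 0%N +
                              radsum n (fun j => t j.+1 *: x j.+1) s)) <=
              avg n (fun s => q (v + radsum n.+1 x (c :: s))).
    apply: le_trans (h c v) _; apply: ler_avg => s _.
    by rewrite radS addrA.
  move=> /le_trans; apply.
  by apply: lerD; rewrite ler_wpM2l// divr_ge0//; lra.
rewrite /=; have := hb true; have := hb false; rewrite /=.
lra.
Qed.

Lemma eq_rad n x y s : (forall j, (j < n)%N -> x j = y j) -> radsum n x s = radsum n y s.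
Proof. by move=> xy; apply: eq_bigr => j _; rewrite xy. Qed.

Lemma avg_rad_le n x (c d : nat -> R) : (forall j, (j < n)%N -> 0 <= c j <= d j) ->
  avg n (fun s => q (radsum n (fun j => c j *: x j) s)) <=
  avg n (fun s => q (radsum n (fun j => d j *: x j) s)).
Proof.
(* The ratio must lie in [0, 1] for every index, hence the 0 past [n]; where [d j = 0], also
   [c j = 0], and the quotient by 0 is 0. *)
move=> cd; pose t j := if (j < n)%N then c j / d j else 0.
have t01 j : 0 <= t j <= 1.
  rewrite /t; case: ifPn => [/cd/andP[c0 cdj]|_]; last by rewrite lexx ler01.
  rewrite divr_ge0//= ?(le_trans c0)//.
  have [->|dN] := eqVneq (d j) 0; first by rewrite invr0 mulr0.
  by rewrite ler_pdivrMr ?mul1r// lt_neqAle eq_sym dN (le_trans c0).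
have := @avg_rad_scale n (fun j => d j *: x j) 0 t t01.
rewrite (@eq_avg _ _ _ (fun s => q (radsum n (fun j => c j *: x j) s))); last first.
  move=> s _; rewrite add0r; congr q; apply: eq_rad => j jn.
  rewrite /t jn scalerA; congr (_ *: _); have /andP[c0 cdj] := cd j jn.
  have [d0|dN] := eqVneq (d j) 0; last by rewrite divfK.
  by rewrite d0 mulr0; apply/esym/le_anti; rewrite c0 -d0 cdj.
rewrite (@eq_avg _ _ (fun s => q (0 + _)) (fun s => q (radsum n (fun j => d j *: x j) s)))//.
by move=> s _; rewrite add0r.
Qed.

Lemma avg_rad_sg n x (b : nat -> bool) (f : V -> R) :
  avg n (fun s => f (radsum n (fun j => sg R (b j) *: x j) s)) =
  avg n (fun s => f (radsum n x s)).
Proof.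
elim: n x b f => [|n IH] x b f /=; first by rewrite /radsum !big_ord0.
have h c : avg n (fun s => f (radsum n.+1 (fun j => sg R (b j) *: x j) (c :: s))) =
  avg n (fun s => f (radsum n.+1 x ((c == b 0%N) :: s))).
  under eq_avg => s _ do rewrite radS.
  rewrite (IH _ (fun j => b j.+1) (fun v => f (_ + v))).
  apply: eq_avg => s _; rewrite radS scalerA; congr (f (_ *: _ + _)).
  by rewrite /sg; case: c; case: (b 0%N); rewrite /= ?mulr1 ?mulN1r ?opprK ?mul1r.
by rewrite !h; case: (b 0%N) => //=; rewrite addrC.
Qed.

End Rademacher.

(** Sylvester's Hadamard matrix, [true] standing for +1: four copies of the previous matrix, located
    by residues, with the sign reversed in the last quadrant only. *)
Fixpoint walsh (a k j : nat) : bool :=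
  if a is a'.+1 then
    walsh a' (k %% 2 ^ a') (j %% 2 ^ a') (+) ((2 ^ a' <= k) && (2 ^ a' <= j))%N
  else true.

Lemma walshC a k j : walsh a k j = walsh a j k.
Proof. by elim: a k j => [|a IH] k j //=; rewrite IH andbC. Qed.

Lemma sg_addb (R : realFieldType) (b c : bool) :
  sg R (b (+) c) = - (sg R b * sg R c).
Proof. by case: b; case: c; rewrite /sg /=; ring. Qed.

(** The second half of the columns repeats the first half up to the quadrant signs of the two rows:
    the sum doubles if both rows lie in the same half and cancels otherwise. *)
Lemma walsh_orthogonal (R : realFieldType) a k l :
  (k < 2 ^ a)%N -> (l < 2 ^ a)%N ->
  \sum_(j < 2 ^ a) sg R (walsh a k j) * sg R (walsh a l j) =
  (2 ^ a)%:R * (k == l)%:R.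
Proof.
elim: a k l => [|a IH] k l.
  by rewrite expn0 !ltnS !leqn0 => /eqP-> /eqP->; rewrite big_ord1 /= /sg !mulr1.
have e2 : (2 ^ a.+1 = 2 ^ a + 2 ^ a)%N by rewrite expnS mul2n addnn.
have a0 : (0 < 2 ^ a)%N by rewrite expn_gt0.
rewrite e2 => kl ll; rewrite big_split_ord /=.
have m k' : (k' %% 2 ^ a < 2 ^ a)%N by rewrite ltn_mod.
have := IH _ _ (m k) (m l); set S := \sum_(_ < _) _ => hS.
have -> : \sum_(i < 2 ^ a)
   sg R (walsh a (k %% 2 ^ a) (i %% 2 ^ a) (+) (2 ^ a <= k) && (2 ^ a <= i))%N *
   sg R (walsh a (l %% 2 ^ a) (i %% 2 ^ a) (+) (2 ^ a <= l) && (2 ^ a <= i))%N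
   = S.
  apply: eq_bigr => i _.
  by rewrite (leqNgt _ i) ltn_ord !andbF !addbF (modn_small (ltn_ord i)).
have -> : \sum_(i < 2 ^ a)
   sg R (walsh a (k %% 2 ^ a) ((2 ^ a + i) %% 2 ^ a) (+) (2 ^ a <= k) && (2 ^ a <= 2 ^ a + i))%N *
   sg R (walsh a (l %% 2 ^ a) ((2 ^ a + i) %% 2 ^ a) (+) (2 ^ a <= l) && (2 ^ a <= 2 ^ a + i))%N
   = sg R (2 ^ a <= k)%N * sg R (2 ^ a <= l)%N * S.
  rewrite mulr_sumr; apply: eq_bigr => i _.
  by rewrite leq_addr !andbT modnDl (modn_small (ltn_ord i)) !sg_addb; ring.
have hm k' : (k' < 2 ^ a + 2 ^ a)%N ->
    (k' %% 2 ^ a = k' - (if 2 ^ a <= k' then 2 ^ a else 0))%N.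
  move=> lt; case: ifP => h; last by rewrite subn0 modn_small// ltnNge h.
  by rewrite -{1}(subnK h) modnDr modn_small// ltn_subLR.
have -> : (k == l) = (k %% 2 ^ a == l %% 2 ^ a)%N && ((2 ^ a <= k) == (2 ^ a <= l))%N.
  by rewrite !hm//; case: (leqP (2 ^ a)) => ?; case: (leqP (2 ^ a)) => ? /=; lia.
rewrite hS; case: eqP => _ /=; last by rewrite mulr0n !mulr0 addr0.
by case: leqP => _; case: leqP => _; rewrite /sg /= ?mulr1n ?mulr0n natrD; ring.
Qed.

Lemma avg_walsh (R : realFieldType) (V : lmodType R) (f : V -> R) n a
  (x : nat -> V) :
  avg n (fun s => \sum_(k < n) f (radsum n (fun j => sg R (walsh a k j) *: x j) s)) =
  n%:R * avg n (fun s => f (radsum n x s)).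
Proof.
rewrite avg_sum (eq_bigr (fun=> avg n (fun s => f (radsum n x s)))).
  by rewrite sumr_const card_ord mulr_natl.
by move=> k _; exact: avg_rad_sg.
Qed.

(** * Comparison of laws by trigonometric polynomials *)

Section SignPolynomial.
Context (R : realType).
Implicit Types (s x eta : R) (m N : nat).

(** A Newton-Schulz step for the sign function: its iterates tend to the sign on [-1, 1] and, being
    polynomials, map trigonometric polynomials to trigonometric polynomials. *)
Definition sgpoly s : R := (3 * s - s ^+ 3) / 2.

Lemma iter_sgpolyN m s : iter m sgpoly (- s) = - iter m sgpoly s.
Proof. by elim: m => [//|m IH]; rewrite !iterS IH /sgpoly; field. Qed.

Lemma iter_sgpoly0 m : iter m sgpoly 0 = 0.
Proof. by elim: m => //= m ->; rewrite /sgpoly expr0n /= mulr0 subr0 mul0r. Qed.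

(** As [1 - sgpoly t = (1 - t) * ((1 - t) * (2 + t) / 2)], each step shrinks the distance to 1 by a
    factor at most [1 - t / 2], and the iterates stay above [s]. *)
Lemma iter_sgpoly_bound m s : 0 < s <= 1 ->
  s <= iter m sgpoly s <= 1 /\ 1 - iter m sgpoly s <= (1 - s / 2) ^+ m.
Proof.
move=> /andP[s0 s1]; elim: m => [|m [/andP[IH1 IH2] IH3]].
  by rewrite /= lexx s1; split => //; rewrite expr0; lra.
rewrite iterS; set t := iter m sgpoly s in IH1 IH2 IH3 *.
have t0 : 0 < t by exact: lt_le_trans IH1.
have E1 : sgpoly t - t = t * (1 - t) * (1 + t) / 2 by rewrite /sgpoly; field.
have E2 : 1 - sgpoly t = (1 - t) * ((1 - t) * (2 + t) / 2).
  by rewrite /sgpoly; field.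
have h1 : 0 <= sgpoly t - t.
  by rewrite E1 divr_ge0// mulr_ge0 ?mulr_ge0//; lra.
have h2 : 0 <= 1 - sgpoly t.
  by rewrite E2 mulr_ge0 ?divr_ge0 ?mulr_ge0//; lra.
split; first by apply/andP; split; lra.
rewrite E2 exprSr ler_pM//; [lra|by rewrite divr_ge0 ?mulr_ge0//; lra|].
have -> : (1 - t) * (2 + t) / 2 = 1 - t / 2 - t ^+ 2 / 2 by field.
have : 0 <= t ^+ 2 by rewrite sqr_ge0.
lra.
Qed.

Lemma normr_iter_sgpoly m s : `|s| <= 1 -> `|iter m sgpoly s| <= 1.
Proof.
move=> s1; have [s0|s0|->] := ltgtP s 0; last first.
- by rewrite iter_sgpoly0 normr0.
- have [|/andP[h1 h2] _] := @iter_sgpoly_bound m s.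
    by rewrite s0 (le_trans (ler_norm _)).
  by rewrite ger0_norm// (le_trans _ h1)// ltW.
- rewrite -[s]opprK iter_sgpolyN normrN.
  have [|/andP[h1 h2] _] := @iter_sgpoly_bound m (- s).
    by rewrite oppr_gt0 s0 (le_trans (ler_norm _))// normrN.
  by rewrite ger0_norm// (le_trans _ h1)// oppr_ge0 ltW.
Qed.

Lemma cvg_iter_sgpoly s : `|s| <= 1 ->
  (iter m sgpoly s @[m --> \oo] --> Num.sg s)%classic.
Proof.
have pos (t : R) : 0 < t <= 1 -> (iter m sgpoly t @[m --> \oo] --> (1 : R))%classic.
  move=> t01; have /andP[t0 t1] := t01.
  have h : ((1 - t / 2) ^+ m @[m --> \oo] --> (0 : R))%classic.
    by apply: cvg_expr; rewrite ger0_norm; lra.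
  apply: (@squeeze_cvgr _ _ _ _ (fun m => 1 - (1 - t / 2) ^+ m) (fun=> 1)).
  - near=> m; have [/andP[_ ->] /=] := iter_sgpoly_bound m t01.
    by rewrite andbT; lra.
  - by rewrite -[X in _ --> X]subr0; apply: cvgB; first exact: cvg_cst.
  - exact: cvg_cst.
move=> s1; have [s0|s0|->] := ltgtP s 0.
- rewrite ltr0_sg// -[s]opprK.
  under eq_fun do rewrite iter_sgpolyN.
  apply: cvgN; apply: pos; rewrite oppr_gt0 s0 /=.
  by rewrite (le_trans (ler_norm _))// normrN.
- by rewrite gtr0_sg//; apply: pos; rewrite s0 (le_trans (ler_norm _)).
- by rewrite sgr0; under eq_fun do rewrite iter_sgpoly0; exact: cvg_cst.
Unshelve. all: by end_near. Qed.

(* A trigonometric polynomial in [x] with values in [0, 1]; as [m] and then [N]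
   tend to infinity it tends to 1 for [|x| < eta] and to 0 for [|x| > eta]. *)
Definition cosgap eta N x : R := (cos (N.+1%:R^-1 * x) - cos (N.+1%:R^-1 * eta)) / 2.

Definition trigbump eta m N x : R := (1 + iter m sgpoly (cosgap eta N x)) / 2.

Lemma cosgap_le1 eta N x : `|cosgap eta N x| <= 1.
Proof.
rewrite /cosgap.
have := cos_le1 (N.+1%:R^-1 * x); have := cos_geN1 (N.+1%:R^-1 * x).
have := cos_le1 (N.+1%:R^-1 * eta); have := cos_geN1 (N.+1%:R^-1 * eta).
by rewrite ler_norml => ? ? ? ?; apply/andP; split; lra.
Qed.

Lemma trigbump01 eta m N x : 0 <= trigbump eta m N x <= 1.
Proof.
have := normr_iter_sgpoly m (cosgap_le1 eta N x).
by rewrite /trigbump ler_norml => /andP[? ?]; apply/andP; split; lra.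
Qed.

Lemma cvg_trigbump_m eta N x :
  (trigbump eta m N x @[m --> \oo] --> (1 + Num.sg (cosgap eta N x)) / 2)%classic.
Proof.
apply: cvgMr_tmp; apply: cvgD; first exact: cvg_cst.
exact/cvg_iter_sgpoly/cosgap_le1.
Qed.

(** Division by a large [N.+1] brings [|x|] and [eta] into [[0, pi]], where [cos] is decreasing;
    this defeats the periodicity of the cosine. *)
Lemma sg_cosgap eta x : 0 < eta ->
  \forall N \near \oo, Num.sg (cosgap eta N x) = Num.sg (eta - `|x|).
Proof.
move=> eta0.
have big (y : R) : \forall N \near \oo, y <= N.+1%:R * pi.
  exists (Num.truncn (y / pi)) => // N /= yN.
  rewrite -ler_pdivrMr ?pi_gt0//; apply: ltW.
  apply: lt_le_trans (truncnS_gt _) _.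
  by rewrite ler_nat ltnS.
near=> N.
have N0 : 0 < N.+1%:R^-1 :> R by rewrite invr_gt0.
have ok (y : R) : 0 <= y -> y <= N.+1%:R * pi -> N.+1%:R^-1 * y \in `[0, pi].
  move=> y0 yN; rewrite in_itv /=; apply/andP; split; first exact: mulr_ge0 (ltW N0) y0.
  by rewrite ler_pdivrMl// invrK.
have okx : N.+1%:R^-1 * `|x| \in `[0, pi].
  apply: ok => //; near: N.
  exact: big.
have oke : N.+1%:R^-1 * eta \in `[0, pi].
  apply: ok => //; first exact: ltW.
  by near: N; exact: big.
have xE : cos (N.+1%:R^-1 * x) = cos (N.+1%:R^-1 * `|x|).
  by rewrite -[LHS]cos_norm normrM gtr0_norm.
rewrite /cosgap xE.
have [xe|xe|xe] := ltgtP `|x| eta.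
- rewrite !gtr0_sg ?subr_gt0// divr_gt0// subr_gt0 ltr_cos//.
  by rewrite ltr_pM2l.
- rewrite !ltr0_sg ?subr_lt0// ltr_pdivrMr// mul0r subr_lt0 ltr_cos//.
  by rewrite ltr_pM2l.
- by rewrite xe !subrr mul0r.
Unshelve. all: by end_near. Qed.

End SignPolynomial.

(** * Integrals of bounded random variables *)

Section RealIntegral.
Context (R : realType) (disp : measure_display) (T : measurableType disp).
Context (P : probability T R).
Implicit Types (f g : T -> R).

Lemma bounded_integrable (M : R) f : measurable_fun setT f ->
  (forall w, `|f w| <= M) -> P.-integrable setT (EFin \o f).
Proof.
move=> mf fM; apply: measurable_bounded_integrable => //.
  by rewrite (le_lt_trans (probability_le1 P measurableT))// ltry.
by exists M; split; [exact: num_real | move=> x Mx w _; exact: le_trans (ltW Mx)].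
Qed.

Lemma cvg_bounded_Rintegral (M : R) (f_ : nat -> T -> R) f :
  (forall n, measurable_fun setT (f_ n)) -> measurable_fun setT f ->
  (forall n w, `|f_ n w| <= M) ->
  {ae P, forall w, f_ ^~ w @ \oo --> f w} ->
  (\int[P]_w f_ n w @[n --> \oo] --> \int[P]_w f w)%classic.
Proof.
move=> mf_ mf fM ff.
have [] := @dominated_convergence _ _ _ P setT measurableT
   (fun n w => (f_ n w)%:E) (fun w => (f w)%:E) (fun=> M%:E).
- by move=> n; exact/measurable_EFinP.
- exact/measurable_EFinP.
- by apply: filterS ff => w ffw _; apply: cvg_EFin => //; exact: nearW.
- apply: (@bounded_integrable `|M| (fun=> M)) => //.
- by apply: aeW => w n _; rewrite lee_fin.
move=> intf _.
have -> : (\int[P]_w (f w)%:E = (\int[P]_w f w)%:E)%E.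
  by rewrite /Rintegral fineK//; exact: integrable_fin_num.
by move=> /fine_cvg.
Qed.

Lemma Rintegral_indic (A : set T) : measurable A ->
  \int[P]_w \1_A w = fine (P A).
Proof. by move=> mA; rewrite /Rintegral integral_indic// setIT. Qed.

Lemma eq_law_Rintegral (X Y : T -> R) (h : R -> R) (M : R) :
  measurable_fun setT X -> measurable_fun setT Y ->
  measurable_fun setT h -> (forall x, `|h x| <= M) ->
  (forall A, measurable A -> P (X @^-1` A) = P (Y @^-1` A)) ->
  \int[P]_w h (X w) = \int[P]_w h (Y w).
Proof.
move=> mX mY mh hM XY; rewrite /Rintegral; congr fine.
have ih (Z : T -> R) : measurable_fun setT Z ->
    P.-integrable setT ((EFin \o h) \o Z).
  move=> mZ; apply: (@bounded_integrable M (h \o Z)) => [|w]; last exact: hM.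
  exact: measurableT_comp.
have mh' : measurable_fun setT (EFin \o h) by exact/measurable_EFinP.
rewrite -[LHS](integral_pushforward mX mh' (ih _ mX) measurableT).
rewrite -[RHS](integral_pushforward mY mh' (ih _ mY) measurableT).
by apply: eq_measure_integral => A mA _; exact: XY.
Qed.

Lemma measurable_forall_normr (I : finType) (Z : I -> T -> R) (eta : R) (b : bool) :
  (forall i, measurable_fun setT (Z i)) ->
  measurable [set w | forall i, `|Z i w| < eta ?<= if b].
Proof.
move=> mZ.
have -> : [set w | forall i, `|Z i w| < eta ?<= if b] =
  \bigcap_(i in [set: I]) [set w | `|Z i w| < eta ?<= if b].
  by apply/seteqP; split=> w /= h i; [move=> _|]; exact: h.
apply: fin_bigcap_measurable => [|i _]; first exact: finite_finset.
have mn : measurable_fun setT (fun w => `|Z i w|) by exact: measurableT_comp.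
case: b => /=.
  rewrite -[X in measurable X]setTI.
  exact: measurable_fun_le measurableT mn (measurable_cst eta).
have -> : [set w | `|Z i w| < eta] = ~` ([set: T] `&` [set w | eta <= `|Z i w|]).
  by rewrite setTI; apply/seteqP; split=> w /=; rewrite ltNge => /negP.
apply: measurableC.
exact: measurable_fun_le measurableT (measurable_cst eta) mn.
Qed.

End RealIntegral.

(** * Probabilities of boxes from integrals of cosines *)

Section LawComparison.
Context (R : realType) (disp : measure_display) (T : measurableType disp).
Context (P : probability T R) (I : finType) (X Y : I -> T -> R).
Hypothesis mX : forall i, measurable_fun setT (X i).
Hypothesis mY : forall i, measurable_fun setT (Y i).
Hypothesis cosXY : forall a : I -> R,
  \int[P]_w cos (\sum_i a i * X i w) = \int[P]_w cos (\sum_i a i * Y i w).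

(* Pairs of the form [(p X, p Y)] with [p] an even trigonometric polynomial. *)
Inductive cos_poly : (T -> R) -> (T -> R) -> Prop :=
| cos_poly_cos (a : I -> R) : cos_poly (fun w => cos (\sum_i a i * X i w))
                                       (fun w => cos (\sum_i a i * Y i w))
| cos_polyD f g f' g' : cos_poly f g -> cos_poly f' g' ->
    cos_poly (fun w => f w + f' w) (fun w => g w + g' w)
| cos_polyZ (c : R) f g : cos_poly f g ->
    cos_poly (fun w => c * f w) (fun w => c * g w).

Let eq_cos_poly f g f' g' : f =1 f' -> g =1 g' -> cos_poly f g -> cos_poly f' g'.
Proof. by move=> /funext -> /funext ->. Qed.

Lemma cos_poly_cst c : cos_poly (fun=> c) (fun=> c).
Proof.
apply: eq_cos_poly (cos_polyZ c (cos_poly_cos (fun=> 0))) => w /=;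
by rewrite big1 ?cos0 ?mulr1// => i _; rewrite mul0r.
Qed.

(** By the product-to-sum formula, cosines alone span an algebra. *)
Lemma cos_polyM f g f' g' : cos_poly f g -> cos_poly f' g' ->
  cos_poly (fun w => f w * f' w) (fun w => g w * g' w).
Proof.
move=> fg; elim: fg f' g' => {f g} [a|f1 g1 f2 g2 _ IH1 _ IH2|c f g _ IH] f' g' fg'.
- elim: fg' => {f' g'} [b|f1 g1 f2 g2 _ IH1 _ IH2|c f g _ IH].
  + have := cos_polyD (cos_polyZ 2^-1 (cos_poly_cos (fun i => a i + b i)))
                      (cos_polyZ 2^-1 (cos_poly_cos (fun i => a i - b i))).
    have E (Z : I -> T -> R) w :
        2^-1 * cos (\sum_i (a i + b i) * Z i w) +
        2^-1 * cos (\sum_i (a i - b i) * Z i w) =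
        cos (\sum_i a i * Z i w) * cos (\sum_i b i * Z i w).
      under eq_bigr do rewrite mulrDl.
      under [X in _ + _ * cos X]eq_bigr do rewrite mulrBl.
      by rewrite big_split /= sumrB cosD cosB; field.
    by apply: eq_cos_poly => w; exact: E.
  + by apply: eq_cos_poly (cos_polyD IH1 IH2) => w; rewrite mulrDr.
  + by apply: eq_cos_poly (cos_polyZ c IH) => w; rewrite mulrCA.
- by apply: eq_cos_poly (cos_polyD (IH1 _ _ fg') (IH2 _ _ fg')) => w;
    rewrite mulrDl.
- by apply: eq_cos_poly (cos_polyZ c (IH _ _ fg')) => w; rewrite mulrA.
Qed.

Lemma cos_poly_prod (r : seq I) (F G : I -> T -> R) :
  (forall i, cos_poly (F i) (G i)) ->
  cos_poly (fun w => \prod_(i <- r) F i w) (fun w => \prod_(i <- r) G i w).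
Proof.
move=> FG; elim: r => [|i r IH].
  by apply: eq_cos_poly (cos_poly_cst 1) => w; rewrite big_nil.
by apply: eq_cos_poly (cos_polyM (FG i) IH) => w; rewrite big_cons.
Qed.

Lemma cos_poly_trigbump eta m N i :
  cos_poly (fun w => trigbump eta m N (X i w)) (fun w => trigbump eta m N (Y i w)).
Proof.
have h : cos_poly (fun w => iter m (@sgpoly R) (cosgap eta N (X i w)))
                  (fun w => iter m (@sgpoly R) (cosgap eta N (Y i w))).
  elim: m => [|m IH] /=.
    have := cos_polyD
      (cos_polyZ 2^-1 (cos_poly_cos (fun j => N.+1%:R^-1 *+ (j == i))))
      (cos_poly_cst (- cos (N.+1%:R^-1 * eta) / 2)).
    have E (Z : I -> T -> R) w :
        \sum_j N.+1%:R^-1 *+ (j == i) * Z j w = N.+1%:R^-1 * Z i w.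
      rewrite (bigD1 i)//= eqxx mulr1n big1 ?addr0// => j /negbTE ->.
      by rewrite mulr0n mul0r.
    by apply: eq_cos_poly => w; rewrite E /cosgap; field.
  have h3 := cos_polyM IH (cos_polyM IH IH).
  apply: eq_cos_poly (cos_polyD (cos_polyZ (3 / 2) IH) (cos_polyZ (- 2^-1) h3)) => w;
  by rewrite /sgpoly; field.
apply: eq_cos_poly (cos_polyD (cos_poly_cst 2^-1) (cos_polyZ 2^-1 h)) => w;
by rewrite /trigbump; field.
Qed.

Let mcos (Z : I -> T -> R) (a : I -> R) : (forall i, measurable_fun setT (Z i)) ->
  measurable_fun setT (fun w => cos (\sum_i a i * Z i w)).
Proof.
move=> mZ; have mc : measurable_fun setT (@cos R).
  apply: continuous_measurable_fun; exact: continuous_cos.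
apply: (measurableT_comp mc).
by apply: measurable_sum => i; apply: measurable_funM.
Qed.

Lemma cos_poly_bounded f g : cos_poly f g ->
  [/\ measurable_fun setT f, measurable_fun setT g &
      exists M, forall w, `|f w| <= M /\ `|g w| <= M].
Proof.
elim=> {f g} [a|f1 g1 f2 g2 _ [mf1 mg1 [M1 h1]] _ [mf2 mg2 [M2 h2]]
             |c f g _ [mf mg [M h]]].
- split; [exact: mcos|exact: mcos|exists 1 => w].
  split; exact: cos_max.
- split; [exact: measurable_funD|exact: measurable_funD|].
  exists (M1 + M2) => w; have [? ?] := h1 w; have [? ?] := h2 w.
  by split; apply: le_trans (ler_normD _ _) _; exact: lerD.
- split; [by apply: measurable_funM|by apply: measurable_funM|].
  exists (`|c| * M) => w; have [? ?] := h w.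
  by split; rewrite normrM ler_wpM2l.
Qed.

Lemma cos_poly_Rintegral f g : cos_poly f g -> \int[P]_w f w = \int[P]_w g w.
Proof.
have int_ f' g' : cos_poly f' g' -> P.-integrable setT (EFin \o f') /\
                                    P.-integrable setT (EFin \o g').
  move=> /cos_poly_bounded[mf mg [M h]].
  by split; apply: (@bounded_integrable _ _ _ _ M) => // w; have [] := h w.
elim=> {f g} [a|f1 g1 f2 g2 h1 e1 h2 e2|c f g h e]; first exact: cosXY.
- have [? ?] := int_ _ _ h1; have [? ?] := int_ _ _ h2.
  by rewrite !RintegralD// e1 e2.
- have [? ?] := int_ _ _ h.
  by rewrite !RintegralZl// e.
Qed.

Lemma cvg_prod_seq (U : Type) (F : set_system U) (FF : Filter F) (r : seq I)
    (h : I -> U -> R) (l : I -> R) :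
  (forall i, h i @ F --> l i)%classic ->
  (\prod_(i <- r) h i u @[u --> F] --> \prod_(i <- r) l i)%classic.
Proof.
move=> hl; elim: r => [|i r IH].
  by rewrite big_nil; under eq_fun do rewrite big_nil; exact: cvg_cst.
rewrite big_cons; under eq_fun do rewrite big_cons.
exact: cvgM (hl i) IH.
Qed.

(** Products of bumps have equal integrals for [X] and [Y], and converge, first in [m] and then in
    [N]. The limit of a bump is 1 inside, 0 outside and 1/2 at [|x| = eta], so the limiting product
    lies between the indicators of the open and of the closed box. *)
Lemma law_comparison (eta : R) : 0 < eta ->
  (P [set w | forall i, `|X i w| < eta]%R <=
   P [set w | forall i, `|Y i w| <= eta]%R)%E.
Proof.
move=> eta0.
pose bump (x : R) : R := (1 + Num.sg (eta - `|x|)) / 2.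
pose bumpN N (x : R) : R := (1 + Num.sg (cosgap eta N x)) / 2.
pose Pm (Z : I -> T -> R) m N w := \prod_i trigbump eta m N (Z i w).
pose PN (Z : I -> T -> R) N w := \prod_i bumpN N (Z i w).
pose PZ (Z : I -> T -> R) w := \prod_i bump (Z i w).
have Pm_cp m N : cos_poly (Pm X m N) (Pm Y m N).
  by apply: cos_poly_prod => i; exact: cos_poly_trigbump.
have prod01 (h : I -> R) : (forall i, 0 <= h i <= 1) -> `|\prod_i h i| <= 1.
  move=> h01; rewrite ger0_norm.
    by apply: prodr_ile1 => i; rewrite h01.
  by apply: prodr_ge0 => i _; have /andP[] := h01 i.
have sg01 (x : R) : 0 <= (1 + Num.sg x) / 2 <= 1.
  by case: sgrP => _; apply/andP; split; lra.
have cvgPm (Z : I -> T -> R) N w :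
    (Pm Z m N w @[m --> \oo] --> PN Z N w)%classic.
  by apply: cvg_prod_seq => i; exact: cvg_trigbump_m.
have cvgPN (Z : I -> T -> R) w :
    (PN Z N w @[N --> \oo] --> PZ Z w)%classic.
  apply: cvg_prod_seq => i; apply: cvg_near_cst.
  have := sg_cosgap (Z i w) eta0; apply: filterS => N h.
  by rewrite /bumpN h.
have key (Z : I -> T -> R) : (forall m N, measurable_fun setT (Pm Z m N)) ->
   [/\ forall N, (\int[P]_w Pm Z m N w @[m --> \oo] --> \int[P]_w PN Z N w)%classic,
    (\int[P]_w PN Z N w @[N --> \oo] --> \int[P]_w PZ Z w)%classic &
    measurable_fun setT (PZ Z)].
  move=> mPm.
  have mPN N : measurable_fun setT (PN Z N).
    apply: (measurable_fun_cvg (h := fun m => Pm Z m N)) => [m|w _]; [exact: mPm|exact: cvgPm].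
  have mPZ : measurable_fun setT (PZ Z).
    apply: (measurable_fun_cvg (h := PN Z)) => [//|w _]; exact: cvgPN.
  split=> //.
  - move=> N; apply: (@cvg_bounded_Rintegral _ _ _ _ 1) => //.
      by move=> m w; apply: prod01 => i; exact: trigbump01.
    by apply: aeW => w; exact: cvgPm.
  - apply: (@cvg_bounded_Rintegral _ _ _ _ 1) => //.
      by move=> m w; apply: prod01 => i; exact: sg01.
    by apply: aeW => w; exact: cvgPN.
have [|X1 X2 mPX] := key X.
  by move=> m N; have [] := cos_poly_bounded (Pm_cp m N).
have [|Y1 Y2 mPY] := key Y.
  by move=> m N; have [] := cos_poly_bounded (Pm_cp m N).
have eN N : \int[P]_w PN X N w = \int[P]_w PN Y N w.
  apply: (cvg_unique _ (X1 N)) => //.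
  have -> : (fun m => \int[P]_w Pm X m N w) = (fun m => \int[P]_w Pm Y m N w).
    by apply/funext => m; exact: cos_poly_Rintegral.
  exact: Y1.
have e : \int[P]_w PZ X w = \int[P]_w PZ Y w.
  apply: (cvg_unique _ X2) => //.
  have -> : (fun N => \int[P]_w PN X N w) = (fun N => \int[P]_w PN Y N w).
    by apply/funext.
  exact: Y2.
have mA := measurable_forall_normr eta false mX.
have mB := measurable_forall_normr eta true mY.
rewrite /= in mA mB.
set A := [set w | _] in mA *; set B := [set w | _] in mB *.
rewrite -(fineK (fin_num_measure P _ mA)) -(fineK (fin_num_measure P _ mB)).
rewrite lee_fin -!Rintegral_indic//.
have i1 (C : set T) : measurable C -> P.-integrable setT (EFin \o \1_C).
  move=> mC; apply: (@bounded_integrable _ _ _ _ 1) => // w.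
  by rewrite indicE ger0_norm//; case: (_ \in _).
have i2 (Z : I -> T -> R) : measurable_fun setT (PZ Z) -> P.-integrable setT (EFin \o PZ Z).
  move=> mZ; apply: (@bounded_integrable _ _ _ _ 1) => // w.
  by apply: prod01 => i; exact: sg01.
have := i1 _ mA => iA; have := i1 _ mB => iB.
apply: (@le_trans _ _ (\int[P]_w PZ X w)); last rewrite e.
  apply: le_Rintegral => //; first exact: i2.
  move=> w _; rewrite indicE; have [wA|wA] := boolP (w \in A); last first.
    by apply: prodr_ge0 => i _; have /andP[] := sg01 (eta - `|X i w|).
  rewrite /PZ big1// => i _; move/set_mem : wA => /(_ i) h.
  by rewrite /bump gtr0_sg ?subr_gt0// divff.
apply: le_Rintegral => //; first exact: i2.
move=> w _; rewrite indicE; have [wB|wB] := boolP (w \in B).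
  by rewrite (le_trans (ler_norm _))// prod01// => i; exact: sg01.
have /existsNP[i /negP] : ~ forall i, `|Y i w| <= eta.
  by move=> h; move/negP : wB; apply; exact/mem_set.
rewrite -ltNge => h.
by rewrite /PZ (bigD1 i)//= /bump ltr0_sg ?subr_lt0// subrr !mul0r.
Qed.

End LawComparison.

(** * One-dimensional Gaussian laws *)

Section NormalMgf.
Context (R : realType).
Local Notation mu := (@lebesgue_measure R).

(** The Radon-Nikodym derivative agrees almost everywhere with [normal_pdf], since both have the
    same integral over every measurable set. *)
Lemma ge0_integral_normal_prob (m s : R) (f : R -> \bar R) :
  measurable_fun setT f -> (forall x, 0 <= f x)%E ->
  (\int[normal_prob m s]_x f x = \int[mu]_x (f x * (normal_pdf m s x)%:E))%E.
Proof.
move=> mf f0; have dom := normal_prob_dominates m s.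
rewrite -(Radon_Nikodym_SigmaFinite.change_of_variables dom f0 measurableT mf).
have iD := Radon_Nikodym_SigmaFinite.f_integrable dom.
apply: ae_eq_integral => //.
- exact: emeasurable_funM mf (measurable_int _ iD).
- apply: emeasurable_funM => //.
  exact: measurable_int (integrable_normal_pdf m s).
- apply: ae_eqe_mul2l; apply: integral_ae_eq => //.
  + exact: measurable_int (integrable_normal_pdf m s).
  + by move=> A _ mA; rewrite -Radon_Nikodym_SigmaFinite.f_integral.
Qed.

Lemma mgf_normal_prob (m s t : R) : s != 0 ->
  (\int[normal_prob m s]_x (expR (t * x))%:E =
   (expR (m * t + s ^+ 2 * t ^+ 2 / 2))%:E)%E.
Proof.
move=> s0; rewrite ge0_integral_normal_prob; last 2 first.
- apply/measurable_EFinP.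
  exact: measurableT_comp (@measurable_expR _) (mulrl_measurable t).
- by move=> x; rewrite lee_fin expR_ge0.
set K := expR (m * t + _).
(* Completing the square: the exponential factor shifts the mean by [s ^+ 2 * t]. *)
have E x : ((expR (t * x))%:E * (normal_pdf m s x)%:E =
           K%:E * (normal_pdf (m + s ^+ 2 * t) s x)%:E)%E.
  rewrite -!EFinM !normal_pdfE// !mulrA [_ * normal_peak s]mulrC.
  rewrite [K * _]mulrC -!mulrA -!expRD; congr (_ * expR _)%:E.
  by field.
under eq_integral do rewrite E.
rewrite ge0_integralZl//.
- by rewrite integral_normal_pdf mule1.
- exact: measurable_int (integrable_normal_pdf _ _).
- by move=> x _; rewrite lee_fin normal_pdf_ge0.
- by rewrite lee_fin expR_ge0.
Qed.

End NormalMgf.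

(** * Identification of centered Gaussian laws *)

Section GaussianLaw.
Context (R : realType) (disp : measure_display) (T : measurableType disp).
Context (P : probability T R).
Implicit Types (X Y : T -> R) (m s t : R).

Lemma mgf_gaussian X m s t : measurable_fun setT X ->
  (forall A, measurable A -> P (X @^-1` A) = gaussian_law m s A) ->
  (\int[P]_w (expR (t * X w))%:E = (expR (m * t + s ^+ 2 * t ^+ 2 / 2))%:E)%E.
Proof.
move=> mX XE.
pose f x := (expR (t * x))%:E : \bar R.
have mf : measurable_fun setT f.
  apply/measurable_EFinP.
  exact: measurableT_comp (@measurable_expR _) (mulrl_measurable t).
have f0 x : x \in [set: R] -> (0 <= f x)%E by move=> _; rewrite lee_fin expR_ge0.
rewrite -[LHS](ge0_integral_pushforward mX P measurableT mf f0).
have [s0|s0] := eqVneq s 0.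
  rewrite (@eq_measure_integral _ _ _ _ (dirac m)); last first.
    by move=> A mA _; rewrite [LHS]XE// /gaussian_law s0 eqxx.
  rewrite integral_dirac//= diracT mul1e /f s0 expr0n /= mul0r mul0r addr0.
  by rewrite mulrC.
have mid : measurable_fun setT (id : measurableTypeR R -> R).
  by move=> _ A mA; rewrite setTI.
rewrite -(mgf_normal_prob _ _ s0).
rewrite -[RHS](ge0_integral_pushforward mid (normal_prob m s) measurableT mf f0).
apply: eq_measure_integral => A mA _.
by rewrite [LHS]XE// /gaussian_law (negbTE s0).
Qed.

(** Integrating [1 + t * X <= expR (t * X)] yields [0 <= m * t + s ^+ 2 * t ^+ 2 / 2] for all [t],
    which fails for some [t] close to 0 unless [m = 0]. *)
Lemma centered_gaussian_mean X m s : measurable_fun setT X ->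
  (forall A, measurable A -> P (X @^-1` A) = gaussian_law m s A) ->
  P.-integrable setT (EFin \o X) -> \int[P]_w X w = 0 -> m = 0.
Proof.
move=> mX XE iX X0.
have h (t : R) : 0 <= m * t + s ^+ 2 * t ^+ 2 / 2.
  rewrite -[leRHS]expRK -ln1 ler_ln ?posrE ?expR_gt0//.
  have M := mgf_gaussian t mX XE.
  rewrite -lee_fin -M.
  have <- : (\int[P]_w (1 + t * X w)%:E = 1)%E.
    under eq_integral do rewrite EFinD EFinM.
    rewrite integralD//=; last 2 first.
    - exact: finite_measure_integrable_cst.
    - exact: integrableZl.
    rewrite integral_cst// mul1e [X in (X + _)%E]probability_setT integralZl//.
    have -> : (\int[P]_w (X w)%:E = 0)%E.
      by rewrite -[LHS]fineK ?integrable_fin_num// [fine _]X0.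
    by rewrite mule0 adde0.
  apply: le_integral => //.
  - under eq_fun do rewrite EFinD EFinM.
    apply: integrableD => //; first exact: finite_measure_integrable_cst.
    exact: integrableZl.
  - apply/integrableP; split.
      by apply/measurable_EFinP; apply: (measurableT_comp (@measurable_expR _));
        apply: measurable_funM.
    under eq_integral do rewrite /= ger0_norm ?expR_ge0//.
    by rewrite M ltry.
  - by move=> w _; rewrite lee_fin expR_ge1Dx.
apply/eqP; apply: contraT => m0.
have m2 : 0 < m ^+ 2 by rewrite exprn_even_gt0.
have s2 : 0 <= s ^+ 2 by exact: sqr_ge0.
(* The [+ 1] keeps the denominator positive when [s = 0]. *)
have := h (- (m / (s ^+ 2 + 1))).
have -> : m * - (m / (s ^+ 2 + 1)) + s ^+ 2 * (- (m / (s ^+ 2 + 1))) ^+ 2 / 2 =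
  - (m ^+ 2 * (s ^+ 2 + 2) / (2 * (s ^+ 2 + 1) ^+ 2)).
  by field; lra.
rewrite oppr_ge0 leNgt divr_gt0//.
  by rewrite mulr_gt0//; lra.
by rewrite mulr_gt0// exprn_gt0//; lra.
Qed.

Lemma gaussian_law_sqr m s t A : s ^+ 2 = t ^+ 2 ->
  gaussian_law m s A = gaussian_law m t A.
Proof.
move=> st; have e : (s == 0) = (t == 0).
  by rewrite -(sqrf_eq0 s) st sqrf_eq0.
rewrite /gaussian_law e; case: ifPn => // t0.
apply: eq_integral => x _; rewrite !normal_pdfE ?e//.
by rewrite /normal_peak /normal_fun st.
Qed.

Lemma ge0_eq_law_integral X Y (f : R -> \bar R) :
  measurable_fun setT X -> measurable_fun setT Y ->
  measurable_fun setT f -> (forall x, 0 <= f x)%E ->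
  (forall A, measurable A -> P (X @^-1` A) = P (Y @^-1` A)) ->
  (\int[P]_w f (X w) = \int[P]_w f (Y w))%E.
Proof.
move=> mX mY mf f0 XY.
rewrite -[LHS](ge0_integral_pushforward mX P measurableT mf (fun x _ => f0 x)).
rewrite -[RHS](ge0_integral_pushforward mY P measurableT mf (fun x _ => f0 x)).
by apply: eq_measure_integral => A mA _; exact: XY.
Qed.

(** If the second moment vanishes, [X] is 0 almost surely and its moment generating function at 1
    equals 1, which forces [s ^+ 2 / 2 = 0]. *)
Lemma gaussian_variance_eq0 X s : measurable_fun setT X ->
  (forall A, measurable A -> P (X @^-1` A) = gaussian_law 0 s A) ->
  (\int[P]_w (X w ^+ 2)%:E = 0)%E <-> s = 0.
Proof.
move=> mX XE; have mX2 : measurable_fun setT (fun w => (X w ^+ 2)%:E).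
  by apply/measurable_EFinP; exact: measurable_funX.
split=> [X20|s0].
  have X0 : {ae P, forall w, setT w -> expR (1 * X w) = 1 :> R}.
    have /(ae_eq_integral_abs P measurableT mX2) :
        (\int[P]_w `|(X w ^+ 2)%:E| = 0)%E.
      rewrite -[RHS]X20; apply: eq_integral => w _.
      by rewrite gee0_abs// lee_fin sqr_ge0.
    apply: filterS => w h /h /= [] /eqP.
    by rewrite sqrf_eq0 => /eqP ->; rewrite mulr0 expR0.
  have := mgf_gaussian 1 mX XE.
  rewrite (@ae_eq_integral _ _ _ P setT (fun=> 1%E))//.
  - rewrite integral_cst// mul1e [LHS]probability_setT.
    move=> []; rewrite -[X in X = _]expR0 => /expR_inj/esym/eqP; rewrite mul0r add0r expr1n mulr1.
    by rewrite mulf_eq0 sqrf_eq0 invr_eq0 pnatr_eq0 orbF => /eqP.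
  - by apply/measurable_EFinP; apply: (measurableT_comp (@measurable_expR _));
      apply: measurable_funM.
  - by apply: filterS X0 => w h /h ->.
pose f (x : R) : \bar R := (x ^+ 2)%:E.
have mf : measurable_fun setT f.
  by apply/measurable_EFinP; exact: measurable_funX.
have f0 x : x \in [set: R] -> (0 <= f x)%E by move=> _; rewrite lee_fin sqr_ge0.
rewrite -[LHS](ge0_integral_pushforward mX P measurableT mf f0).
rewrite (@eq_measure_integral _ _ _ _ (dirac (0 : R))); last first.
  by move=> A mA _; rewrite [LHS]XE// /gaussian_law s0 eqxx.
by rewrite integral_dirac//= diracT mul1e /f expr0n.
Qed.

(* Equality of the second moments of the variables fixes the variance of the
   normal law only up to a constant [E[Z^2]], whose value need not be known:
   rescaling [X] to the parameter of [Y] shows that the scale is 1. *)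
Lemma gaussian_eq_law X Y :
  measurable_fun setT X -> measurable_fun setT Y ->
  (forall c, gaussian_variable P (fun w => c * X w)) -> gaussian_variable P Y ->
  P.-integrable setT (EFin \o X) -> P.-integrable setT (EFin \o Y) ->
  \int[P]_w X w = 0 -> \int[P]_w Y w = 0 ->
  (\int[P]_w (X w ^+ 2)%:E < +oo)%E ->
  (\int[P]_w (X w ^+ 2)%:E = \int[P]_w (Y w ^+ 2)%:E)%E ->
  forall A, measurable A -> P (X @^-1` A) = P (Y @^-1` A).
Proof.
move=> mX mY gX gY iX iY X0 Y0 X2 XY.
have mcX c : measurable_fun setT (fun w => c * X w) by apply: measurable_funM.
have icX c : P.-integrable setT (EFin \o (fun w => c * X w)).
  exact: (integrableZl measurableT c iX).
have cX0 c : \int[P]_w (c * X w) = 0 by rewrite RintegralZl// X0 mulr0.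
have gX1 : gaussian_variable P X.
  have -> : X = (fun w => 1 * X w) by apply/funext => w; rewrite mul1r.
  exact: gX.
have [m [s Xs]] := gX1.
have m0 := centered_gaussian_mean mX Xs iX X0; rewrite {}m0 {m} in Xs.
have [m [t Yt]] := gY.
have m0 := centered_gaussian_mean mY Yt iY Y0; rewrite {}m0 {m} in Yt.
suff st : s ^+ 2 = t ^+ 2.
  by move=> A mA; rewrite Xs// Yt//; exact: gaussian_law_sqr.
have [s0|/eqP s0] := eqVneq s 0.
  rewrite s0 (proj1 (gaussian_variance_eq0 mY Yt))//.
  by rewrite -XY; exact/(gaussian_variance_eq0 mX Xs).
have t0 : t <> 0.
  by move=> /(gaussian_variance_eq0 mY Yt); rewrite -XY => /(gaussian_variance_eq0 mX Xs).
have [m [r Zr]] := gX (t / s).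
have m0 := centered_gaussian_mean (mcX _) Zr (icX _) (cX0 _).
rewrite {}m0 {m} in Zr.
have rt : r ^+ 2 = t ^+ 2.
  have := mgf_gaussian 1 (mcX (t / s)) Zr.
  under eq_integral do rewrite mul1r.
  rewrite (mgf_gaussian (t / s) mX Xs) => -[] /expR_inj.
  rewrite !mul0r !add0r expr1n mulr1 => e.
  have -> : r ^+ 2 = 2 * (r ^+ 2 / 2) by field.
  by rewrite -e; field; exact/eqP.
have law : forall A, measurable A ->
    P ((fun w => t / s * X w) @^-1` A) = P (Y @^-1` A).
  by move=> A mA; rewrite Zr// Yt//; exact: gaussian_law_sqr.
pose f (x : R) : \bar R := (x ^+ 2)%:E.
have mf : measurable_fun setT f.
  by apply/measurable_EFinP; exact: measurable_funX.
have f0 x : (0 <= f x)%E by rewrite lee_fin sqr_ge0.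
have := ge0_eq_law_integral (mcX (t / s)) mY mf f0 law.
rewrite /f -XY; under eq_integral do rewrite exprMn EFinM.
rewrite ge0_integralZl//; last 3 first.
- by apply/measurable_EFinP; exact: measurable_funX.
- by move=> w _; rewrite lee_fin sqr_ge0.
- by rewrite lee_fin sqr_ge0.
have Xfin : (\int[P]_w (X w ^+ 2)%:E)%E \is a fin_num.
  by rewrite ge0_fin_numE// integral_ge0// => w _; rewrite lee_fin sqr_ge0.
have XN0 : (\int[P]_w (X w ^+ 2)%:E)%E != 0%E.
  by apply/eqP => /(gaussian_variance_eq0 mX Xs).
rewrite -(fineK Xfin) -EFinM => -[] /eqP.
rewrite -subr_eq0 -[X in _ - X]mul1r -mulrBl mulf_eq0 => /orP[|]; last first.
  move=> /eqP e; case/eqP: XN0; by rewrite -(fineK Xfin) e.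
rewrite subr_eq0 => /eqP e.
have -> : t ^+ 2 = (t / s) ^+ 2 * s ^+ 2 by field; exact/eqP.
by rewrite e mul1r.
Qed.

End GaussianLaw.

(** * Oscillation off a finite net *)

Section Nets.
Context (R : realType).

Lemma ler_coord_norm n (x : 'rV[R]_n) i : `|x ord0 i| <= `|x|.
Proof.
rewrite [leRHS]/Num.norm /= mx_normrE.
exact: (le_bigmax _ (fun j => `|x j.1 j.2|) (ord0, i)).
Qed.

Lemma rV_norm_le n (x : 'rV[R]_n) (K : R) : 0 <= K ->
  (forall i, `|x ord0 i| <= K) -> `|x| <= K.
Proof.
move=> K0 xK; rewrite [leLHS]/Num.norm /= mx_normrE; apply/bigmax_leP.
by split=> // -[i j] _ /=; rewrite (ord1 i).
Qed.

(** Links the limit at infinity, taken in the Euclidean norm, to the max norm in which balls and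
    nets are measured. *)
Lemma ler_norm_euclidean d (u : 'rV[R]_d) : `|u| <= euclidean_norm u.
Proof.
apply: rV_norm_le; first exact: sqrtr_ge0.
move=> i; rewrite -sqrtr_sqr /euclidean_norm ler_sqrt ?sumr_ge0//; last first.
  by move=> j _; exact: sqr_ge0.
by rewrite (bigD1 i)//= lerDl sumr_ge0// => j _; exact: sqr_ge0.
Qed.

Lemma closed_ball_compact d (M : R) : compact [set u : 'rV[R]_d | `|u| <= M].
Proof.
apply: bounded_closed_compact.
  by exists M; split; [exact: num_real|move=> x Mx u /= /le_trans; apply; exact: ltW].
have -> : [set u : 'rV[R]_d | `|u| <= M] = (fun u => `|u|) @^-1` [set x | x <= M].
  by [].
apply: closed_comp; last exact: closed_le.
by move=> u _; exact: norm_continuous.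
Qed.

(** Only [u] is confined to [K]: the net point compared with it may lie outside. *)
Lemma compact_unif_continuous d (f : 'rV[R]_d -> R) (K : set 'rV[R]_d) (e : R) :
  compact K -> continuous f -> 0 < e ->
  exists2 r, 0 < r & forall u v, K u -> `|u - v| < r -> `|f u - f v| < e.
Proof.
move=> cK cf e0.
pose Q (r : R) u := forall v, `|u - v| < r -> `|f u - f v| < e.
have : \forall r \near 0^'+, K `<=` Q r.
  apply: (proj1 (compact_near_coveringP K) cK) => u Ku.
  have /cvgrPdist_lt/(_ (e / 2)) := cf u.
  rewrite divr_gt0// => /(_ isT)/nbhs_ballP[r /= r0 ur].
  have {}ur v : `|u - v| < r -> `|f u - f v| < e / 2.
    by move=> uv; apply: ur; rewrite -ball_normE.
  exists (ball_ Num.norm u (r / 2), [set t | 0 < t < r / 2]) => /=.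
    split; last first.
      near=> t; apply/andP; split; near: t; first exact: nbhs_right_gt.
      by apply: nbhs_right_lt; rewrite divr_gt0.
    by apply/nbhs_ballP; exists (r / 2) => /=; [rewrite divr_gt0|move=> v; rewrite -ball_normE].
  move=> [v t] /= [uv /andP[t0 tr]] w vw.
  have h1 : `|f u - f v| < e / 2.
    by apply: ur => /=; rewrite (lt_le_trans uv)// ler_pdivrMr// ler_peMr// ?ltW// ltr1n.
  have h2 : `|f u - f w| < e / 2.
    apply: ur => /=; rewrite /ball_ /= in uv *.
    have -> : u - w = (u - v) + (v - w) by rewrite addrA subrK.
    rewrite (le_lt_trans (ler_normD _ _))// [r]splitr ltrD//.
    exact: lt_trans tr.
  have -> : f v - f w = (f u - f w) - (f u - f v) by ring.
  by rewrite (le_lt_trans (ler_normB _ _))// [e]splitr ltrD.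
move=> h; have : \forall r \near 0^'+, (0 < r) /\ K `<=` Q r.
  by near=> r; split; near: r => //; exact: nbhs_right_gt.
move=> /filter_ex[r [r0 Kr]]; exists r => // u v Ku; exact: Kr.
Unshelve. all: by end_near. Qed.

(** The outside of the ball of radius [k] serves as a neighbourhood of infinity: its points are
    represented by points that also lie in it. *)
Definition is_net d (k : nat) (N : seq 'rV[R]_d) (p : 'rV[R]_d -> 'rV[R]_d) : Prop :=
  [/\ forall u, p u \in N,
      forall u, `|u| <= k%:R -> `|u - p u| < k.+1%:R^-1 &
      forall u, k%:R < `|u| -> k%:R < `|p u| ].

Lemma net_exists d (k : nat) : (1 <= d)%N -> exists N p, @is_net d k N p.
Proof.
move=> d1; have e0 : 0 < k.+1%:R^-1 :> R by rewrite invr_gt0.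
pose far : 'rV[R]_d := const_mx k.+1%:R.
have farE : k%:R < `|far|.
  rewrite /far; case: d d1 {far} => // d _.
  by rewrite (lt_le_trans _ (ler_coord_norm _ ord0))// mxE ger0_norm// ltr_nat.
have := @closed_ball_compact d k%:R; rewrite compact_cover.
move=> /(_ 'rV[R]_d setT (fun c => ball c k.+1%:R^-1)) [].
- by move=> c _; exact: ball_open.
- by move=> u _; exists u => //; exact: ballxx.
move=> D _ cov.
have pick u : exists c, (c \in far :: finmap.enum_fset D) /\
    (if `|u| <= k%:R then is_true (`|u - c| < k.+1%:R^-1) else c = far).
  case: (boolP (`|u| <= k%:R)) => [uk|_]; last by exists far; rewrite mem_head.
  have [c /= cD uc] := cov u uk; exists c; split.
    by rewrite in_cons cD orbT.
  by move: uc; rewrite -ball_normE /ball_ /= distrC.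
have [p hp] := choice pick.
exists (far :: finmap.enum_fset D), p; split.
- by move=> u; case: (hp u).
- by move=> u uk; have [_] := hp u; rewrite uk.
- by move=> u uk; have [_] := hp u; rewrite leNgt uk /= => ->.
Qed.

Lemma net_approx d (N : nat -> seq 'rV[R]_d) p (f : 'rV[R]_d -> R) (l e : R) :
  (forall k, is_net k (N k) (p k)) -> continuous f ->
  f u @[u --> @norm_infty R d] --> l -> 0 < e ->
  \forall k \near \oo, forall u, `|f u - f (p k u)| < e.
Proof.
move=> net cf fl e0; have e20 : 0 < e / 2 by rewrite divr_gt0.
have [M _ fM] := fl _ (nbhsx_ballx l (e / 2) e20).
have {}fM u : M < `|u| -> `|l - f u| < e / 2.
  move=> Mu; have := fM u; rewrite /= -ball_normE; apply.
  exact: lt_le_trans (ler_norm_euclidean u).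
have farb u v : M < `|u| -> M < `|v| -> `|f u - f v| < e.
  move=> /fM hu /fM hv.
  have -> : f u - f v = (l - f v) - (l - f u) by ring.
  by rewrite (le_lt_trans (ler_normB _ _))// [e]splitr ltrD.
(* The radius is [M + 1] because a net point at distance at most 1 from some [u] outside this ball
   is still beyond [M]. *)
have [r r0 unif] := compact_unif_continuous (@closed_ball_compact d (M + 1)) cf e0.
near=> k => u.
have [_ near_p far_p] := net k.
have kM : M < k%:R by near: k; exact: nbhs_infty_gtr.
have kr : k.+1%:R^-1 < r by near: k; exact: near_infty_natSinv_lt (PosNum r0).
have [uk|uk] := leP `|u| k%:R; last first.
  by apply: farb; [exact: lt_trans uk|exact: lt_trans (far_p u uk)].
have up := near_p u uk.
have [uM|uM] := leP `|u| (M + 1).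
  by apply: unif => //; exact: lt_trans kr.
apply: farb; first by rewrite (lt_trans _ uM)// ltrDl.
have k1 : k.+1%:R^-1 <= 1 :> R by rewrite invf_le1// ler1n.
have uD : `|u| <= `|u - p k u| + `|p k u|.
  by rewrite -{1}[u](subrK (p k u)) ler_normD.
rewrite -(ltrD2r 1) (lt_le_trans uM)// (le_trans uD)// addrC lerD2l.
exact: le_trans (ltW up) k1.
Unshelve. all: by end_near. Qed.

End Nets.

(** * Tightness of the field over finite sets of points *)

Section NetOscillation.
Context (R : realType) (d : nat) (disp : measure_display).
Context (T : measurableType disp) (P : probability T R).
Context (zeta zetac : 'rV[R]_d -> {RV P >-> R}).
Hypothesis hmod : modification zeta zetac.
Hypothesis hcont : continuous_paths zetac.
Hypothesis hlim : {ae P, forall w, exists l : R,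
             zetac u w @[u --> @norm_infty R d] --> l}.

Lemma modification_ae u : {ae P, forall w, zetac u w = zeta u w}.
Proof.
have mA : measurable [set w | zetac u w = zeta u w].
  have -> : [set w | zetac u w = zeta u w] = (fun w => zetac u w - zeta u w) @^-1` [set 0].
    by apply/seteqP; split=> w /= => [->|/eqP]; rewrite ?subrr// subr_eq0 => /eqP.
  rewrite -[X in measurable X]setTI.
  by apply: measurable_funB.
exists (~` [set w | zetac u w = zeta u w]); split => //.
- exact: measurableC.
- by rewrite probability_setC// hmod subee.
Qed.

(* A tightness statement on the one-point compactification of R^d, for
   arbitrary finite sets of points so that no separability is needed. *)
Lemma net_oscillation (e delta : R) : (1 <= d)%N -> 0 < e -> 0 < delta ->
  exists (N : seq 'rV[R]_d) (p : 'rV[R]_d -> 'rV[R]_d), (forall u, p u \in N) /\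
    forall r (u : 'I_r -> 'rV[R]_d),
      ((1 - delta)%:E <=
       P [set w | forall i, `|zeta (u i) w - zeta (p (u i)) w| < e]%R)%E.
Proof.
move=> d1 e0 delta0.
have [N hN] := choice (fun k => @net_exists R d k d1).
have [p {}hN] := choice hN.
apply: contrapT => /forallNP noN.
(* One failing finite configuration is fixed for each [k]; dominated convergence will show that the
   probabilities of their events tend to 1, a contradiction. *)
have bad k : exists r (u : 'I_r -> 'rV[R]_d),
    (P [set w | forall i, `|zeta (u i) w - zeta (p k (u i)) w| < e]%R < (1 - delta)%:E)%E.
  have /forallNP/(_ (p k)) := noN (N k).
  move=> /not_andP[/existsNP[u]|]; first by have [] := hN k.
  move=> /existsNP[r /existsNP[u /negP]]; rewrite -ltNge => h.
  by exists r, u.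
have [r {}bad] := choice bad.
pose A k (u : 'I_(r k) -> 'rV[R]_d) :=
  [set w | forall i, `|zeta (u i) w - zeta (p k (u i)) w| < e].
have [u {}bad] : exists u : forall k, 'I_(r k) -> 'rV[R]_d,
    forall k, (P (A k (u k)) < (1 - delta)%:E)%E.
  exists (fun k => sval (cid (bad k))) => k; exact: svalP (cid (bad k)).
have mA k : measurable (A k (u k)).
  apply: (@measurable_forall_normr _ _ _ _ _ e false) => i.
  exact: measurable_funB.
have good : {ae P, forall w, \1_(A k (u k)) w @[k --> \oo] --> (1 : R)}.
  (* Only countably many points occur in these configurations, so a single null set covers the
     passage from [zeta] to [zetac]. *)
  have eq_ae : {ae P, forall w, forall k (i : 'I_(r k)),
      zetac (u k i) w = zeta (u k i) w /\
      zetac (p k (u k i)) w = zeta (p k (u k i)) w}.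
    apply: ae_foralln => k.
    have : {ae P, forall w, forall j, if insub j is Some i then
       zetac (u k i) w = zeta (u k i) w /\
       zetac (p k (u k i)) w = zeta (p k (u k i)) w else True}.
      apply: ae_foralln => j; case: insub => [i|]; last by apply: aeW.
      have := modification_ae (u k i); have := modification_ae (p k (u k i)).
      by apply: filterS2.
    by apply: filterS => w h i; have := h i; rewrite valK.
  apply: filterS2 eq_ae hlim => w eqw [l wl].
  have := net_approx hN (@hcont w) wl e0.
  move=> near_e; apply: cvg_near_cst; apply: filterS near_e => k hk.
  rewrite indicE mem_set// => i; have [<- <-] := eqw k i; exact: hk.
have cv : (\int[P]_w \1_(A k (u k)) w @[k --> \oo] --> \int[P]_w (cst 1 w : R))%classic.
  apply: (@cvg_bounded_Rintegral _ _ _ _ 1 (fun k => \1_(A k (u k)))) => //.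
  by move=> k w; rewrite indicE ger0_norm//; case: (_ \in _).
have : \forall k \near \oo, 1 - delta < \int[P]_w \1_(A k (u k)) w.
  have := cvgr_gt _ cv; apply.
  have -> : \int[P]_w (cst 1 w : R) = 1.
    rewrite Rintegral_cst// mul1r.
    by have /(congr1 fine) := probability_setT P.
  by rewrite ltrBlDr ltrDl.
move=> /filter_ex[k]; rewrite Rintegral_indic// => h.
have := bad k; rewrite -(fineK (fin_num_measure P _ (mA k))) lte_fin.
by rewrite ltNge ltW.
Qed.

End NetOscillation.

(** * Linear functionals of the field *)

Section GaussianSpace.
Context (R : realType) (H : completeNormedModType R) (dot : {dot H for idfun}).
Context (d : nat) (rho : 'rV[R]_d -> H).
Context (disp : measure_display) (T : measurableType disp) (P : probability T R).
Context (zeta : 'rV[R]_d -> {RV P >-> R}).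
Hypothesis hgauss : gaussian_field zeta.
Hypothesis hcentered : centered_field zeta.
Hypothesis hcov : forall u v,
  ('E_P[zeta u \* zeta v] = (dot (rho u) (rho v))%:E)%E.
Local Notation U := 'rV[R]_d.
Implicit Types (X Y : T -> R) (x y : H).

Lemma dotC x y : dot x y = dot y x.
Proof. by rewrite hermC /= expr0 mul1r. Qed.

Lemma dotDl x y z : dot (x + y) z = dot x z + dot y z.
Proof. exact: linearDl. Qed.

Lemma dotZl c x y : dot (c *: x) y = c * dot x y.
Proof. exact: linearZl_LR. Qed.

Lemma dotZr c x y : dot x (c *: y) = c * dot x y.
Proof. by rewrite dotC dotZl dotC. Qed.

Lemma dot0l x : dot 0 x = 0.
Proof. by rewrite -(scale0r (0 : H)) dotZl mul0r. Qed.

Lemma dot0r x : dot x 0 = 0.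
Proof. by rewrite dotC dot0l. Qed.

Lemma dotNl x y : dot (- x) y = - dot x y.
Proof. by rewrite -scaleN1r dotZl mulN1r. Qed.

Lemma dotBl x y z : dot (x - y) z = dot x z - dot y z.
Proof. by rewrite dotDl dotNl. Qed.

Lemma dotBr x y z : dot z (x - y) = dot z x - dot z y.
Proof. by rewrite dotC dotBl !(dotC z). Qed.

Lemma dot_suml (I : Type) (s : seq I) (p : pred I) (F : I -> H) y :
  dot (\sum_(i <- s | p i) F i) y = \sum_(i <- s | p i) dot (F i) y.
Proof.
elim: s => [|i s IH]; first by rewrite !big_nil dot0l.
rewrite !big_cons; case: (p i); last exact: IH.
by rewrite dotDl IH.
Qed.

Lemma dot_sumr (I : Type) (s : seq I) (p : pred I) (F : I -> H) x :
  dot x (\sum_(i <- s | p i) F i) = \sum_(i <- s | p i) dot x (F i).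
Proof.
by rewrite dotC dot_suml; apply: eq_bigr => i _; rewrite dotC.
Qed.

(* [X] is the linear functional [<x, .>] of the field: the same combination of
   values of [zeta] and of [rho]. *)
Definition represents X x : Prop := exists l : seq (R * U),
  (forall w, X w = \sum_(p <- l) p.1 * zeta p.2 w) /\
  x = \sum_(p <- l) p.1 *: rho p.2.

Lemma represents_field u : represents (zeta u) (rho u).
Proof.
by exists [:: (1, u)]; split=> [w|]; rewrite big_seq1 /= ?mul1r ?scale1r.
Qed.

Lemma represents0 : represents (fun=> 0) 0.
Proof. by exists [::]; split=> [w|]; rewrite big_nil. Qed.

Lemma representsD X Y x y : represents X x -> represents Y y ->
  represents (fun w => X w + Y w) (x + y).
Proof.
move=> [l [Xl ->]] [k [Yk ->]]; exists (l ++ k).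
by split=> [w|]; rewrite big_cat /= ?Xl ?Yk.
Qed.

Lemma representsZ c X x : represents X x -> represents (fun w => c * X w) (c *: x).
Proof.
move=> [l [Xl ->]]; exists [seq (c * p.1, p.2) | p <- l].
split=> [w|]; rewrite big_map /= ?Xl ?mulr_sumr ?scaler_sumr.
  by apply: eq_bigr => p _; rewrite mulrA.
by apply: eq_bigr => p _; rewrite scalerA.
Qed.

Lemma representsB X Y x y : represents X x -> represents Y y ->
  represents (fun w => X w - Y w) (x - y).
Proof.
move=> hX hY; have := representsD hX (representsZ (-1) hY).
by rewrite scaleN1r; congr represents; apply/funext => w; rewrite mulN1r.
Qed.

Lemma represents_sum (I : Type) (s : seq I) (X : I -> T -> R) (x : I -> H) :
  (forall i, represents (X i) (x i)) ->
  represents (fun w => \sum_(i <- s) X i w) (\sum_(i <- s) x i).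
Proof.
move=> h; elim: s => [|i s IH].
  rewrite big_nil; have := represents0; congr represents.
  by apply/funext => w; rewrite big_nil.
rewrite big_cons; have := representsD (h i) IH.
by congr represents; apply/funext => w; rewrite big_cons.
Qed.

Lemma represents_measurable X x : represents X x -> measurable_fun setT X.
Proof.
move=> [l [/funext -> _]]; apply: measurable_sum => p.
by apply: measurable_funM.
Qed.

Lemma represents_gaussian X x : represents X x -> gaussian_variable P X.
Proof.
move=> [l [/funext -> _]].
have := hgauss (fun i : 'I_(size l) => (tnth (in_tuple l) i).2)
               (fun i : 'I_(size l) => (tnth (in_tuple l) i).1).
congr gaussian_variable; apply/funext => w.
by rewrite [RHS]big_tnth.
Qed.

Let intZ (f : T -> R) c : P.-integrable setT (EFin \o f) ->
  P.-integrable setT (EFin \o (fun w => c * f w)).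
Proof. by move=> h; exact: (integrableZl measurableT c h). Qed.

Let intD (f g : T -> R) : P.-integrable setT (EFin \o f) -> P.-integrable setT (EFin \o g) ->
  P.-integrable setT (EFin \o (fun w => f w + g w)).
Proof. by move=> hf hg; exact: (integrableD measurableT hf hg). Qed.

Let int_le (f g : T -> R) : measurable_fun setT f -> (forall w, `|f w| <= g w) ->
  P.-integrable setT (EFin \o g) -> P.-integrable setT (EFin \o f).
Proof.
move=> mf fg ig; apply: le_integrable ig => //; first exact/measurable_EFinP.
by move=> w _ /=; rewrite lee_fin (le_trans (fg w))// ler_norm.
Qed.

(** The diagonal case of [hcov] has a finite value and gives square integrability; products follow
    from [|a b| <= a ^+ 2 + b ^+ 2]. *)
Lemma field_cov_integrable u v :
  P.-integrable setT (EFin \o (fun w => zeta u w * zeta v w)) /\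
  \int[P]_w (zeta u w * zeta v w) = dot (rho u) (rho v).
Proof.
have sq a : P.-integrable setT (EFin \o (fun w => zeta a w ^+ 2)).
  apply/integrableP; split; first by apply/measurable_EFinP; exact: measurable_funX.
  have := hcov a a; rewrite unlock => e.
  rewrite (_ : (\int[P]_w _)%E = (dot (rho a) (rho a))%:E) ?ltry// -e.
  by apply: eq_integral => w _ /=; rewrite ger0_norm ?sqr_ge0// expr2.
split.
  apply: (@int_le _ (fun w => zeta u w ^+ 2 + zeta v w ^+ 2)).
  - exact: measurable_funM.
  - move=> w; rewrite normrM.
    have := sqr_ge0 (`|zeta u w| - `|zeta v w|).
    rewrite -[zeta u w ^+ 2]real_normK ?num_real// -[zeta v w ^+ 2]real_normK ?num_real//.
    have : 0 <= `|zeta u w| ^+ 2 by exact: sqr_ge0.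
    have : 0 <= `|zeta v w| ^+ 2 by exact: sqr_ge0.
    rewrite sqrrB; lra.
  - exact: intD.
by have := hcov u v; rewrite unlock /Rintegral => ->.
Qed.

Lemma represents_cov X Y x y : represents X x -> represents Y y ->
  P.-integrable setT (EFin \o (fun w => X w * Y w)) /\
  \int[P]_w (X w * Y w) = dot x y.
Proof.
(* Linearity in the first factor, used twice: with [Z] a value of the field, then with [Z := Y]. *)
have step Z z : measurable_fun setT Z ->
    (forall u, P.-integrable setT (EFin \o (fun w => zeta u w * Z w)) /\
               \int[P]_w (zeta u w * Z w) = dot (rho u) z) ->
    forall X x, represents X x ->
    P.-integrable setT (EFin \o (fun w => X w * Z w)) /\
    \int[P]_w (X w * Z w) = dot x z.
  move=> mZ hZ {}X {}x [l [/funext -> ->]] /=; elim: l => [|[a u] l [IH1 IH2]].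
    rewrite big_nil dot0l.
    have -> : (fun w : T => (\sum_(p <- [::]) p.1 * zeta p.2 w) * Z w) = cst 0.
      by apply/funext => w; rewrite big_nil mul0r.
    split; first exact: finite_measure_integrable_cst.
    by rewrite /Rintegral integral0.
  have [h1 h2] := hZ u.
  have E : (fun w => (\sum_(p <- (a, u) :: l) p.1 * zeta p.2 w) * Z w) =
     (fun w => a * (zeta u w * Z w) + (\sum_(p <- l) p.1 * zeta p.2 w) * Z w).
    by apply/funext => w; rewrite big_cons mulrDl mulrA.
  rewrite E; split; first by apply: intD => //; exact: intZ.
  rewrite RintegralD//; last exact: intZ.
  by rewrite RintegralZl// h2 IH2 big_cons dotDl dotZl.
move=> hX hY; apply: (step Y y _ _ X x hX); first exact: represents_measurable hY.
move=> u.
have [] := step (zeta u) (rho u) _ _ Y y hY => //.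
  by move=> v; exact: field_cov_integrable.
move=> h1 h2; rewrite dotC -h2.
by split; [congr (_.-integrable _ (EFin \o _)): h1|congr Rintegral];
  apply/funext => w; rewrite mulrC.
Qed.

Lemma represents_mean X x : represents X x ->
  P.-integrable setT (EFin \o X) /\ \int[P]_w X w = 0.
Proof.
have fieldP u : P.-integrable setT (EFin \o zeta u) /\ \int[P]_w zeta u w = 0.
  split; last by have := hcentered u; rewrite unlock /Rintegral => ->.
  have [h _] := field_cov_integrable u u.
  apply: (@int_le _ (fun w => 1 + zeta u w * zeta u w)) => //.
    move=> w; have := sqr_ge0 (`|zeta u w| - 1).
    rewrite -expr2 -[zeta u w ^+ 2]real_normK ?num_real// sqrrB.
    have : 0 <= `|zeta u w| ^+ 2 by exact: sqr_ge0.
    have : 0 <= `|zeta u w| by [].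
    lra.
  apply: intD => //; exact: finite_measure_integrable_cst.
move=> [l [/funext -> _]]; elim: l => [|[a u] l [IH1 IH2]].
  rewrite (_ : (fun w : T => \sum_(p <- [::]) p.1 * zeta p.2 w) = cst 0).
    split; first exact: finite_measure_integrable_cst.
    by rewrite /Rintegral integral0.
  by apply/funext => w; rewrite big_nil.
have [h1 h2] := fieldP u.
have -> : (fun w => \sum_(p <- (a, u) :: l) p.1 * zeta p.2 w) =
     (fun w => a * zeta u w + \sum_(p <- l) p.1 * zeta p.2 w).
  by apply/funext => w; rewrite big_cons.
split; first by apply: intD => //; exact: intZ.
rewrite RintegralD//; last exact: intZ.
by rewrite RintegralZl// h2 IH2 mulr0 addr0.
Qed.

Lemma represents_eq_law X Y x y : represents X x -> represents Y y ->
  dot x x = dot y y -> forall A, measurable A -> P (X @^-1` A) = P (Y @^-1` A).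
Proof.
move=> hX hY xy.
have [iX X0] := represents_mean hX; have [iY Y0] := represents_mean hY.
have [iX2 X2] := represents_cov hX hX; have [iY2 Y2] := represents_cov hY hY.
have E Z z : P.-integrable setT (EFin \o (fun w => Z w * Z w)) ->
    \int[P]_w (Z w * Z w) = z -> (\int[P]_w (Z w ^+ 2)%:E = z%:E)%E.
  move=> iZ <-; rewrite /Rintegral fineK; last exact: integrable_fin_num.
  by apply: eq_integral => w _; rewrite expr2.
apply: gaussian_eq_law => //.
- exact: represents_measurable hX.
- exact: represents_measurable hY.
- move=> c; exact: represents_gaussian (representsZ c hX).
- exact: represents_gaussian hY.
- by rewrite (E _ _ iX2 X2) ltry.
- by rewrite (E _ _ iX2 X2) (E _ _ iY2 Y2) xy.
Qed.

(** Equal Gram matrices give corresponding linear combinations the same variance, hence the same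
    one-dimensional law and the same integral of the cosine. *)
Lemma represents_comparison (I : finType) (X Y : I -> T -> R) (x y : I -> H) (e : R) :
  (forall i, represents (X i) (x i)) -> (forall i, represents (Y i) (y i)) ->
  (forall i j, dot (x i) (x j) = dot (y i) (y j)) -> 0 < e ->
  (P [set w | forall i, `|X i w| < e]%R <=
   P [set w | forall i, `|Y i w| <= e]%R)%E.
Proof.
move=> hX hY xy e0; apply: law_comparison => //.
- by move=> i; exact: represents_measurable (hX i).
- by move=> i; exact: represents_measurable (hY i).
move=> a.
have big (Z : I -> T -> R) (z : I -> H) : (forall i, represents (Z i) (z i)) ->
    represents (fun w => \sum_i a i * Z i w) (\sum_i a i *: z i).
  by move=> hZ; apply: represents_sum => i; exact: representsZ.
have E (z : I -> H) : dot (\sum_i a i *: z i) (\sum_i a i *: z i) =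
    \sum_i \sum_j a i * (a j * dot (z i) (z j)).
  rewrite dot_suml; apply: eq_bigr => i _.
  rewrite dot_sumr; apply: eq_bigr => j _.
  by rewrite dotZl dotZr.
have hXa := big _ _ hX; have hYa := big _ _ hY.
apply: (@eq_law_Rintegral _ _ _ _ _ _ _ 1) => //.
- exact: represents_measurable hXa.
- exact: represents_measurable hYa.
- by apply: continuous_measurable_fun; exact: continuous_cos.
- exact: cos_max.
- apply: represents_eq_law hXa hYa _; rewrite !E.
  by apply: eq_bigr => i _; apply: eq_bigr => j _; rewrite xy.
Qed.

(** All unit functionals share one law, so the same threshold and probability serve for all of them;
    unit variance prevents this law from being concentrated at 0. *)
Lemma unit_represents_tail : exists2 t : R, 0 < t & exists2 p : R, 0 < p &
  forall X x, represents X x -> dot x x = 1 ->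
    (p%:E <= P [set w | t <= `|X w|]%R)%E.
Proof.
have [[X0 [x0 [hX0 x01]]]|no] := pselect (exists X x, represents X x /\ dot x x = 1);
  last first.
  exists 1 => //; exists 1 => // X x hX x1; exfalso; apply: no.
  by exists X, x.
have mX0 := represents_measurable hX0.
have mtail (t : R) (X : T -> R) : measurable_fun setT X ->
    measurable [set w | t <= `|X w|].
  move=> mX; rewrite -[X in measurable X]setTI.
  have mn : measurable_fun setT (fun w => `|X w|) by exact: measurableT_comp.
  exact: measurable_fun_le measurableT (measurable_cst t) mn.
have [k Pk] : exists k : nat, P [set w | k.+1%:R^-1 <= `|X0 w|] != 0%E.
  apply: contrapT => /forallNP allz.
  have X00 : {ae P, forall w, X0 w = 0}.
    have : {ae P, forall w k, ~ (k.+1%:R^-1 <= `|X0 w|)}.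
      apply: ae_foralln => k; exists [set w | k.+1%:R^-1 <= `|X0 w|].
      split; [exact: mtail|by apply/eqP/negP => /negP; exact: allz|].
      by move=> w /= /contrapT.
    apply: filterS => w h; apply/eqP; apply: contraT => X0N.
    have : 0 < `|X0 w| by rewrite normr_gt0.
    move=> X0p; have [k _ /(_ k (leqnn k)) /= kX] := near_infty_natSinv_lt (PosNum X0p).
    by case: (h k); exact: ltW.
  have [iX2] := represents_cov hX0 hX0; rewrite x01.
  rewrite /Rintegral (@ae_eq_integral _ _ _ P setT (fun=> 0%E)) ?integral0//=.
  - by move/eqP; rewrite eq_sym oner_eq0.
  - exact: measurable_int iX2.
  - by apply: filterS X00 => w -> _; rewrite mulr0.
have Pf := fin_num_measure P _ (mtail k.+1%:R^-1 X0 mX0).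
exists k.+1%:R^-1; first by rewrite invr_gt0.
exists (fine (P [set w | k.+1%:R^-1 <= `|X0 w|])).
  by rewrite fine_gt0// lt0e Pk measure_ge0 /= -ge0_fin_numE.
move=> X x hX x1; rewrite fineK//.
have law := represents_eq_law hX0 hX (etrans x01 (esym x1)).
have mA : measurable [set y : R | k.+1%:R^-1 <= `|y|].
  rewrite -[X in measurable X]setTI.
  apply: measurable_fun_le => //; exact: measurableT_comp.
by have := law _ mA => ->.
Qed.

End GaussianSpace.

(** * Averages of random variables over signs *)

Section AverageIntegral.
Context (R : realType) (disp : measure_display) (T : measurableType disp).
Context (P : probability T R).

Lemma avg_measurable n (f : seq bool -> T -> R) :
  (forall s, size s = n -> measurable_fun setT (f s)) ->
  measurable_fun setT (fun w => avg n (f ^~ w)).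
Proof.
elim: n f => [|n IH] f mf /=; first exact: mf.
have h b : measurable_fun setT (fun w => avg n (fun s => f (b :: s) w)).
  by apply: (IH (fun s => f (b :: s))) => s ss; apply: mf; rewrite /= ss.
by apply: measurable_funM => //; exact: measurable_funD.
Qed.

Lemma Rintegral_avg n (f : seq bool -> T -> R) :
  (forall s, size s = n -> P.-integrable setT (EFin \o f s)) ->
  P.-integrable setT (EFin \o (fun w => avg n (f ^~ w))) /\
  \int[P]_w avg n (f ^~ w) = avg n (fun s => \int[P]_w f s w).
Proof.
elim: n f => [|n IH] f intf /=; first by split=> //; exact: intf.
have h b := IH (fun s => f (b :: s)) (fun s (ss : size s = n) =>
  intf (b :: s) (congr1 S ss)).
have [i1 e1] := h true; have [i0 e0] := h false.
have iD := integrableD measurableT i1 i0.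
split.
  by have := integrableZl measurableT 2^-1 iD; congr (_.-integrable _ _);
    apply/funext => w /=; rewrite mulrC.
have -> : (fun w => (avg n (fun s => f (true :: s) w) +
                     avg n (fun s => f (false :: s) w)) / 2) =
          (fun w => 2^-1 * (avg n (fun s => f (true :: s) w) +
                     avg n (fun s => f (false :: s) w))).
  by apply/funext => w; rewrite mulrC.
by rewrite RintegralZl// RintegralD// e1 e0 mulrC.
Qed.

Lemma Rintegral_lin (I : Type) (s : seq I) (c : I -> R) (f : I -> T -> R) :
  (forall i, P.-integrable setT (EFin \o f i)) ->
  P.-integrable setT (EFin \o (fun w => \sum_(i <- s) c i * f i w)) /\
  \int[P]_w (\sum_(i <- s) c i * f i w) = \sum_(i <- s) c i * \int[P]_w f i w.
Proof.
move=> intf; elim: s => [|i s [IH1 IH2]].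
  have -> : (fun w => \sum_(i <- [::]) c i * f i w) = cst 0.
    by apply/funext => w; rewrite big_nil.
  rewrite big_nil; split; first exact: finite_measure_integrable_cst.
  by rewrite /Rintegral integral0.
have h := integrableZl measurableT (c i) (intf i).
have -> : (fun w => \sum_(k <- i :: s) c k * f k w) =
          (fun w => c i * f i w + \sum_(k <- s) c k * f k w).
  by apply/funext => w; rewrite big_cons.
split; first exact: (integrableD measurableT h IH1).
by rewrite RintegralD// RintegralZl// IH2 big_cons.
Qed.

Lemma rV_norm_measurable r (X : T -> 'rV[R]_r) :
  (forall i, measurable_fun setT (fun w => X w ord0 i)) ->
  measurable_fun setT (fun w => `|X w|).
Proof.
move=> mX.
have -> : (fun w => `|X w|) = (fun w => \big[Num.max/0]_ij `|X w ij.1 ij.2|).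
  by apply/funext => w; rewrite [LHS]/Num.norm /= mx_normrE.
elim: (index_enum _) => [|[i j] s IH].
  by under eq_fun do rewrite big_nil; exact: measurable_cst.
under eq_fun do rewrite big_cons.
apply: measurable_maxr => //=; rewrite (ord1 i).
exact: measurableT_comp.
Qed.

End AverageIntegral.

(** * Rademacher average of a block *)

Section Block.
Context (R : realType) (H : completeNormedModType R) (dot : {dot H for idfun}).
Context (d : nat) (rho : 'rV[R]_d -> H).
Context (disp : measure_display) (T : measurableType disp) (P : probability T R).
Context (zeta : 'rV[R]_d -> {RV P >-> R}).
Hypothesis hgauss : gaussian_field zeta.
Hypothesis hcentered : centered_field zeta.
Hypothesis hcov : forall u v,
  ('E_P[zeta u \* zeta v] = (dot (rho u) (rho v))%:E)%E.
Local Notation U := 'rV[R]_d.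
Context (n : nat) (e : nat -> H) (g : nat -> T -> R).
Hypothesis eON : forall i j, (i < n)%N -> (j < n)%N -> dot (e i) (e j) = (i == j)%:R.
Hypothesis ge : forall j, (j < n)%N -> represents rho zeta (g j) (e j).
Implicit Types (s : seq bool) (x y : H) (X : T -> R) (u : U).

(** Equal to 0 or 2: subtracting twice a coordinate reverses it. *)
Let b s j : R := 1 - sg R (nth false s j).

Let eON1 (i : 'I_n) : dot (e i) (e i) = 1.
Proof. by rewrite eON// eqxx. Qed.

Let eON0 (i j : 'I_n) : j != i -> dot (e i) (e j) = 0.
Proof. by move=> ji; rewrite eON// eq_sym (val_eqE j i) (negbTE ji). Qed.

(* The isometry flipping the sign of the coordinates [e j] with [~~ s_j]. *)
Definition reflection s x : H := x - \sum_(j < n) (b s j * dot x (e j)) *: e j.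

Definition reflection_rv s X x w : R :=
  X w - \sum_(j < n) (b s j * dot x (e j)) * g j w.

(** Since [b] takes the values 0 and 2, its square is [2 * b], and the quadratic term cancels the
    two cross terms. *)
Lemma dot_reflection s x y : dot (reflection s x) (reflection s y) = dot x y.
Proof.
rewrite /reflection dotBl !dotBr !dot_suml !dot_sumr.
have -> : \sum_(i < n) dot x ((b s i * dot y (e i)) *: e i) =
    \sum_(i < n) b s i * (dot x (e i) * dot y (e i)).
  by apply: eq_bigr => i _; rewrite dotZr; ring.
have -> : \sum_(i < n) dot ((b s i * dot x (e i)) *: e i) y =
    \sum_(i < n) b s i * (dot x (e i) * dot y (e i)).
  by apply: eq_bigr => i _; rewrite dotZl (dotC _ (e i)); ring.
have -> : \sum_(i < n) dot ((b s i * dot x (e i)) *: e i)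
     (\sum_(j < n) (b s j * dot y (e j)) *: e j) =
   \sum_(i < n) b s i * b s i * (dot x (e i) * dot y (e i)).
  apply: eq_bigr => i _; rewrite dot_sumr (bigD1 i)//= dotZl dotZr eON1.
  rewrite big1 ?addr0; first by ring.
  by move=> j ji; rewrite dotZl dotZr eON0// !mulr0.
have -> : \sum_(i < n) b s i * b s i * (dot x (e i) * dot y (e i)) =
   2 * \sum_(i < n) b s i * (dot x (e i) * dot y (e i)).
  rewrite mulr_sumr; apply: eq_bigr => i _.
  have -> : b s i * b s i = 2 * b s i by rewrite /b; case: nth; rewrite /sg; ring.
  by rewrite mulrA.
ring.
Qed.

Lemma represents_reflection s X x : represents rho zeta X x ->
  represents rho zeta (reflection_rv s X x) (reflection s x).
Proof.
move=> hX; apply: representsB => //.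
by apply: represents_sum => i; apply: representsZ; exact: ge.
Qed.

Definition signed_block s u w : R :=
  \sum_(j < n) sg R (nth false s j) * dot (rho u) (e j) * g j w.

Lemma signed_blockE s u w : size s = n ->
  signed_block s u w =
  (reflection_rv s (zeta u) (rho u) w -
   reflection_rv (map negb s) (zeta u) (rho u) w) / 2.
Proof.
move=> ss; rewrite /reflection_rv.
have -> : \sum_(j < n) b (map negb s) j * dot (rho u) (e j) * g j w =
  2 * signed_block s u w + \sum_(j < n) b s j * dot (rho u) (e j) * g j w.
  rewrite /signed_block mulr_sumr -big_split; apply: eq_bigr => j _ /=.
  rewrite /b (nth_map false) ?ss//; case: nth; rewrite /sg /=; ring.
by field.
Qed.

Lemma represents_signed_block s u : represents rho zeta (signed_block s u)
  (\sum_(j < n) (sg R (nth false s j) * dot (rho u) (e j)) *: e j).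
Proof. by apply: represents_sum => i; apply: representsZ; exact: ge. Qed.

Lemma signed_block_var s u :
  P.-integrable setT (EFin \o (fun w => signed_block s u w ^+ 2)) /\
  \int[P]_w (signed_block s u w ^+ 2) = \sum_(j < n) dot (rho u) (e j) ^+ 2.
Proof.
have hB := represents_signed_block s u.
have [h1 h2] := represents_cov hcov hB hB.
have E : (fun w => signed_block s u w ^+ 2) =
         (fun w => signed_block s u w * signed_block s u w).
  by apply/funext => w; rewrite expr2.
rewrite E h2; split=> //; rewrite dot_suml; apply: eq_bigr => i _.
rewrite dot_sumr (bigD1 i)//= dotZl dotZr eON1 big1 ?addr0.
  by case: nth; rewrite /sg; ring.
by move=> j ji; rewrite dotZl dotZr eON0// !mulr0.
Qed.

Context (e0 K delta : R) (N : seq U) (p : U -> U).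
Hypothesis e0_gt0 : 0 < e0.
Hypothesis K_gt0 : 0 < K.
Hypothesis pN : forall u, p u \in N.
Hypothesis osc : forall r (u : 'I_r -> U),
  ((1 - delta)%:E <=
       P [set w | forall i, `|zeta (u i) w - zeta (p (u i)) w| < e0]%R)%E.
Hypothesis var_small :
  \sum_(q <- N) \sum_(j < n) dot (rho q) (e j) ^+ 2 <= delta * K ^+ 2.
Context (r : nat) (u : 'I_r -> U).

Lemma measurable_signed_block s v : measurable_fun setT (signed_block s v).
Proof. exact: represents_measurable (represents_signed_block s v). Qed.

(** Reflections preserve Gram matrices, so the tightness of the field passes to its reflections; the
    comparison of laws turns [<] into [<=]. *)
Lemma reflection_osc s : (1 - delta <=
  fine (P [set w | forall i, `|reflection_rv s (zeta (u i)) (rho (u i)) w -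
          reflection_rv s (zeta (p (u i))) (rho (p (u i))) w| <= e0]))%R.
Proof.
have mA : measurable [set w | forall i, `|reflection_rv s (zeta (u i)) (rho (u i)) w -
          reflection_rv s (zeta (p (u i))) (rho (p (u i))) w| <= e0].
  apply: (@measurable_forall_normr _ _ _ _ _ e0 true) => i.
  by apply: measurable_funB; apply: represents_measurable;
    apply: represents_reflection; exact: represents_field.
rewrite -lee_fin fineK ?fin_num_measure//.
apply: le_trans (osc u) _.
apply: (represents_comparison hgauss hcentered hcov
  (x := fun i => rho (u i) - rho (p (u i)))
  (y := fun i => reflection s (rho (u i)) - reflection s (rho (p (u i))))) => //.
- by move=> i; apply: representsB; exact: represents_field.
- by move=> i; apply: representsB; apply: represents_reflection;
    exact: represents_field.
- move=> i j.
  have E (x1 x2 y1 y2 : H) : dot (x1 - x2) (y1 - y2) =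
      dot x1 y1 - dot x1 y2 - (dot x2 y1 - dot x2 y2).
    by rewrite dotBl !dotBr.
  by rewrite [LHS]E [RHS]E !dot_reflection.
Qed.

Let phi j : 'rV[R]_r := \row_i dot (rho (u i)) (e j).

Lemma rad_signed_block s w i :
  radsum n (fun j => g j w *: phi j) s ord0 i = signed_block s (u i) w.
Proof.
rewrite /radsum summxE; apply: eq_bigr => j _; rewrite !mxE; ring.
Qed.

(* With [s'] the opposite of [s], the signed block is half the difference of two
   reflections of the field, and both have the law of [zeta]. *)
Lemma signed_block_tail s : size s = n ->
  measurable [set w | e0 + K < `|radsum n (fun j => g j w *: phi j) s|] /\
  fine (P [set w | e0 + K < `|radsum n (fun j => g j w *: phi j) s|]) <= 3 * delta.
Proof.
move=> ss.
set A := [set w | e0 + K < _].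
pose C t := [set w | forall i, `|reflection_rv t (zeta (u i)) (rho (u i)) w -
          reflection_rv t (zeta (p (u i))) (rho (p (u i))) w| <= e0].
have mC t : measurable (C t).
  apply: (@measurable_forall_normr _ _ _ _ _ e0 true) => i.
  by apply: measurable_funB; apply: represents_measurable;
    apply: represents_reflection; exact: represents_field.
have K0 : 0 <= e0 + K by rewrite addr_ge0// ltW.
have AE : A = ~` [set w | forall i, `|signed_block s (u i) w| <= e0 + K].
  apply/seteqP; split=> w /=; rewrite /A /= ltNge.
    move=> /negP h h'; apply: h; apply: rV_norm_le => // i.
    by rewrite rad_signed_block.
  move=> h; apply/negP => h'; apply: h => i.
  by rewrite -rad_signed_block (le_trans (ler_coord_norm _ _)).
have mA : measurable A.
  rewrite AE; apply: measurableC.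
  apply: (@measurable_forall_normr _ _ _ _ _ (e0 + K) true) => i.
  exact: measurable_signed_block.
split=> //.
pose V w := \sum_(q <- N) signed_block s q w ^+ 2.
have [iV eV] : P.-integrable setT (EFin \o V) /\
    \int[P]_w V w = \sum_(q <- N) \sum_(j < n) dot (rho q) (e j) ^+ 2.
  rewrite /V; elim: N => [|q N' [IH1 IH2]].
    have -> : (fun w => \sum_(q <- [::]) signed_block s q w ^+ 2) = cst 0.
      by apply/funext => w; rewrite big_nil.
    rewrite big_nil; split; first exact: finite_measure_integrable_cst.
    by rewrite /Rintegral integral0.
  have [h1 h2] := signed_block_var s q.
  have -> : (fun w => \sum_(q <- q :: N') signed_block s q w ^+ 2) =
    (fun w => signed_block s q w ^+ 2 + \sum_(q <- N') signed_block s q w ^+ 2).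
    by apply/funext => w; rewrite big_cons.
  split; first exact: (integrableD measurableT h1 IH1).
  by rewrite RintegralD// h2 IH2 big_cons.
have i1 (B : set T) : measurable B -> P.-integrable setT (EFin \o \1_B).
  move=> mB; apply: (@bounded_integrable _ _ _ _ 1) => // w.
  by rewrite indicE ger0_norm//; case: (_ \in _).
pose s' := map negb s.
(* Three ways to fail, each of probability at most [delta]: the oscillation of either reflection, or
   a net value above [K], handled by Chebyshev's inequality and a union bound over the net. *)
have bound w : \1_A w <= \1_(~` C s) w + \1_(~` C s') w + K ^- 2 * V w.
  have V0 : 0 <= K ^- 2 * V w.
    by rewrite mulr_ge0 ?invr_ge0 ?sqr_ge0//; apply: sumr_ge0 => q _; exact: sqr_ge0.
  rewrite !indicE !in_setC.
  case: (boolP (w \in C s)) => [/set_mem Cs|_]; last first.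
    by rewrite /=; case: (w \in A); case: (w \in C s'); rewrite /=; lra.
  case: (boolP (w \in C s')) => [/set_mem Cs'|_]; last first.
    by rewrite /=; case: (w \in A); rewrite /=; lra.
  case: (boolP (w \in A)) => [/set_mem wA|_]; last by rewrite /=; lra.
  rewrite /= !add0r.
  have [i Ki] : exists i, e0 + K < `|signed_block s (u i) w|.
    move: wA; rewrite AE /= => /existsNP[i /negP]; rewrite -ltNge => h.
    by exists i.
  have hp : K < `|signed_block s (p (u i)) w|.
    have := Cs i; have := Cs' i.
    move: Ki; rewrite !signed_blockE// -/s'.
    set a1 := reflection_rv s (zeta (u i)) _ w.
    set a2 := reflection_rv s' (zeta (u i)) _ w.
    set b1 := reflection_rv s (zeta (p (u i))) _ w.
    set b2 := reflection_rv s' (zeta (p (u i))) _ w.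
    move=> h1 h2 h3.
    have : `|(a1 - a2) / 2| <= `|(b1 - b2) / 2| + (`|a1 - b1| + `|a2 - b2|) / 2.
      have -> : (a1 - a2) / 2 = (b1 - b2) / 2 + ((a1 - b1) - (a2 - b2)) / 2 by field.
      apply: le_trans (ler_normD _ _) _; rewrite lerD2l normrM.
      rewrite [`|2^-1|]ger0_norm// ler_pM2r// ?invr_gt0//.
      exact: ler_normB.
    lra.
  rewrite ler_pdivlMl ?exprn_gt0// mulr1 /V.
  rewrite (big_rem (p (u i))) ?pN//=.
  apply: (@le_trans _ _ (signed_block s (p (u i)) w ^+ 2)).
    rewrite -[leRHS]real_normK ?num_real// ler_pXn2r// ?nnegrE ?ltW//.
  by rewrite lerDl; apply: sumr_ge0 => q _; exact: sqr_ge0.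
have iKV := integrableZl measurableT (K ^- 2) iV.
have i12 := integrableD measurableT (i1 _ (measurableC (mC s))) (i1 _ (measurableC (mC s'))).
rewrite -Rintegral_indic//.
apply: (@le_trans _ _ (\int[P]_w (\1_(~` C s) w + \1_(~` C s') w + K ^- 2 * V w))).
  apply: le_Rintegral => //; first exact: i1.
  exact: (integrableD measurableT i12 iKV).
rewrite RintegralD// RintegralD//;
  [|exact: i1 (measurableC (mC s))|exact: i1 (measurableC (mC s'))].
rewrite RintegralZl// eV !Rintegral_indic//; [|exact: measurableC..].
have PC t : fine (P (~` C t)) <= delta.
  rewrite probability_setC// fineB ?fin_num_measure//=.
  have := reflection_osc t; rewrite -/(C t); lra.
have h3 : K ^- 2 * \sum_(q <- N) \sum_(j < n) dot (rho q) (e j) ^+ 2 <= delta.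
  by rewrite ler_pdivrMl ?exprn_gt0// mulrC.
have := PC s; have := PC s'; lra.
Qed.

Context (t0 p0 : R).
Hypothesis t0_gt0 : 0 < t0.
Hypothesis p0_gt0 : 0 < p0.
Hypothesis tail : forall j, (j < n)%N -> (p0%:E <= P [set w | t0 <= `|g j w|]%R)%E.
Hypothesis deltaE : delta = p0 / 48.

Let nD (x y : 'rV[R]_r) : `|x + y| <= `|x| + `|y|.
Proof. exact: ler_normD. Qed.

Let nZ (a : R) (x : 'rV[R]_r) : `|a *: x| = `|a| * `|x|.
Proof. exact: normrZ. Qed.

(** The Gaussian weights are traded for constants. For most [w] the block is small for most signs,
    which bounds its Rademacher average; contraction cuts [|g j w|] down to [t0] times an indicator,
    Jensen's inequality replaces the result by its mean [alpha j], and a second contraction replaces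
    that by [t0 * p0 / 2]. *)
Lemma block_average :
  avg n (fun s => `|radsum n phi s|) <= 6 * (e0 + K) / (t0 * p0).
Proof.
set K' := e0 + K; have K'0 : 0 <= K' by rewrite addr_ge0// ltW.
pose A s := [set w | K' < `|radsum n (fun j => g j w *: phi j) s|].
have mA s : size s = n -> measurable (A s) by case/signed_block_tail.
have i1 (B : set T) : measurable B -> P.-integrable setT (EFin \o \1_B).
  move=> mB; apply: (@bounded_integrable _ _ _ _ 1) => // w.
  by rewrite indicE ger0_norm//; case: (_ \in _).
pose h w : R := avg n (fun s => \1_(A s) w).
have mh : measurable_fun setT h.
  by apply: (avg_measurable (f := fun s => \1_(A s))) => s ss; apply: measurable_indic; exact: mA.
have [ih eh] : P.-integrable setT (EFin \o h) /\
    \int[P]_w h w = avg n (fun s => \int[P]_w \1_(A s) w).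
  by apply: Rintegral_avg => s ss; apply: i1; exact: mA.
have h_le : \int[P]_w h w <= 3 * delta.
  rewrite eh -(avg_cst n (3 * delta)); apply: ler_avg => s ss.
  by rewrite Rintegral_indic; [case: (signed_block_tail ss)|exact: mA].
(* The threshold is that of [rademacher_L0_L1]. The mean of [h] is at most [3 * delta = p0 / 16], so
   Markov's inequality leaves at most [p0 / 2] outside [G], half of the bound on the tails. *)
pose G := [set w | h w <= 1 / 8].
have mG : measurable G.
  rewrite -[X in measurable X]setTI.
  exact: measurable_fun_le measurableT mh (measurable_cst _).
have PG : fine (P (~` G)) <= p0 / 2.
  rewrite -Rintegral_indic; last exact: measurableC.
  apply: (@le_trans _ _ (\int[P]_w (8 * h w))).
    apply: le_Rintegral => //; first exact: i1 (measurableC mG).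
      exact: (integrableZl measurableT 8 ih).
    move=> w _; have h0 : 0 <= h w.
      by apply: avg_ge0 => s _; rewrite indicE.
    rewrite indicE in_setC; case: (boolP (w \in G)) => [_|wG] /=.
      by rewrite mulr_ge0.
    have : ~ (h w <= 1 / 8) by move=> hw; move/negP: wG; apply; exact/mem_set.
    by move/negP; rewrite -ltNge; lra.
  by rewrite RintegralZl//; move: h_le; rewrite deltaE; lra.
pose E j := [set w | t0 <= `|g j w|].
have mg j : (j < n)%N -> measurable_fun setT (g j).
  by move=> jn; exact: represents_measurable (ge jn).
have mE j : (j < n)%N -> measurable (E j).
  move=> jn; rewrite -[X in measurable X]setTI.
  apply: measurable_fun_le => //; apply: measurableT_comp => //; exact: mg.
have mGE (j : 'I_n) : measurable (G `&` E j) by apply: measurableI => //; exact: mE.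
pose rr j w : R := t0 * \1_(G `&` E j) w.
have rr_avg w : avg n (fun s => `|radsum n (fun j => rr j w *: phi j) s|) <= 3 * K'.
  have [wG|wG] := boolP (w \in G); last first.
    rewrite (@eq_avg _ _ _ (fun=> 0)) ?avg_cst ?mulr_ge0// => s _.
    rewrite (_ : radsum _ _ _ = 0) ?normr0// /radsum big1// => j _.
    rewrite /rr indicE (_ : (w \in G `&` E j) = false) ?mulr0 ?scale0r ?scaler0//.
    by rewrite in_setI (negbTE wG).
  have := @rademacher_L0_L1 _ _ _ nD nZ n (fun j => g j w *: phi j) K' K'0.
  move=> /(_ _)/(le_trans _); apply; last first.
    move/set_mem: wG; rewrite /G /= /h; congr (_ <= _).
    apply: eq_avg => s _; rewrite indicE; congr (_%:R).
    by congr nat_of_bool; apply/idP/idP => [/set_mem|?]; [|exact/mem_set].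
  apply: (@le_trans _ _ (avg n (fun s => `|radsum n (fun j => `|g j w| *: phi j) s|))).
    apply: (avg_rad_le nD nZ) => j jn; rewrite /rr indicE.
    case: (boolP (w \in _)) => [/set_mem[_ wE]|_]; rewrite ?mulr1 ?mulr0 //.
      by rewrite (ltW t0_gt0).
    by rewrite lexx normr_ge0.
  rewrite le_eqVlt; apply/orP; left; apply/eqP.
  rewrite -(avg_rad_sg n (fun j => g j w *: phi j) (fun j => 0 <= g j w)
    (fun x : 'rV[R]_r => `|x|)).
  apply: eq_avg => s _; congr `|_|; apply: eq_rad => j _; rewrite scalerA; congr (_ *: _).
  by rewrite /sg; case: ger0P => [h0|h0]; rewrite ?ger0_norm ?ltr0_norm ?mul1r ?mulN1r.
pose F s w : R := `|radsum n (fun j => rr j w *: phi j) s|.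
have irr (j : 'I_n) : P.-integrable setT (EFin \o rr j).
  exact: (integrableZl measurableT t0 (i1 _ (mGE j))).
have coordE s w i : radsum n (fun j => rr j w *: phi j) s ord0 i =
    \sum_(j < n) (sg R (nth false s j) * phi j ord0 i) * rr j w.
  by rewrite /radsum summxE; apply: eq_bigr => j _; rewrite !mxE; ring.
have iF s : P.-integrable setT (EFin \o F s).
  apply: (@bounded_integrable _ _ _ _ (\sum_(j < n) t0 * `|phi j|)).
    apply: rV_norm_measurable => i; under eq_fun do rewrite coordE.
    apply: measurable_sum => j; apply: measurable_funM => //.
    by apply/measurable_EFinP; exact: measurable_int (irr j).
  move=> w; rewrite normr_id (le_trans (ler_norm_sum _ _ _))//.
  apply: ler_sum => j _; rewrite normrZ normr_sgb mul1r normrZ ler_wpM2r//.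
  rewrite /rr normrM ger0_norm ?(ltW t0_gt0)// ler_piMr ?(ltW t0_gt0)//.
  by rewrite indicE ger0_norm//; case: (_ \in _).
pose alpha j := \int[P]_w rr j w.
have jensen s : `|radsum n (fun j => alpha j *: phi j) s| <= \int[P]_w F s w.
  apply: rV_norm_le; first by apply: Rintegral_ge0 => w _; exact: normr_ge0.
  move=> i; have [ic ec] := Rintegral_lin (index_enum 'I_n)
    (fun j => sg R (nth false s j) * phi j ord0 i) irr.
  have -> : radsum n (fun j => alpha j *: phi j) s ord0 i =
      \int[P]_w (\sum_(j < n) (sg R (nth false s j) * phi j ord0 i) * rr j w).
    by rewrite ec /radsum summxE; apply: eq_bigr => j _; rewrite !mxE /alpha; ring.
  apply: le_trans (le_normr_Rintegral _ _) _ => //.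
  apply: le_Rintegral => //; first exact: integrable_norm.
  by move=> w _; rewrite -coordE ler_coord_norm.
have alpha_avg : avg n (fun s => `|radsum n (fun j => alpha j *: phi j) s|) <= 3 * K'.
  have [iA eA] := @Rintegral_avg _ _ _ P n F (fun s _ => iF s).
  apply: (@le_trans _ _ (avg n (fun s => \int[P]_w F s w))).
    by apply: ler_avg => s _; exact: jensen.
  rewrite -eA; apply: (@le_trans _ _ (\int[P]_w cst (3 * K') w)).
    apply: le_Rintegral => //; first exact: finite_measure_integrable_cst.
    by move=> w _; exact: rr_avg.
  rewrite Rintegral_cst//.
  by have /(congr1 fine) /= -> := probability_setT P; rewrite mulr1.
have alpha_ge j : (j < n)%N -> 0 <= t0 * p0 / 2 <= alpha j.
  move=> jn; apply/andP; split; first by rewrite divr_ge0// mulr_ge0// ltW.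
  rewrite /alpha /rr RintegralZl//; last exact: i1 (mGE (Ordinal jn)).
  rewrite Rintegral_indic; last exact: (mGE (Ordinal jn)).
  rewrite -mulrA ler_pM2l//.
  have hE : p0 <= fine (P (E j)).
    by rewrite -lee_fin fineK ?fin_num_measure//; [exact: tail|exact: mE].
  have : fine (P (E j)) <= fine (P (G `&` E j)) + fine (P (~` G)).
    have mGEj : measurable (G `&` E j) := mGE (Ordinal jn).
    have mEj := mE j jn; have mCG := measurableC mG.
    rewrite -lee_fin EFinD !fineK ?fin_num_measure//.
    apply: le_trans (measureU2 _ _ _) => //.
    apply: le_measure; rewrite ?inE//; first exact: measurableU.
    by move=> w wE; case: (pselect (G w)) => wG; [left|right].
  lra.
have := avg_rad_le nD nZ phi alpha_ge.
rewrite (@eq_avg _ _ (fun s => `|radsum n (fun j => (t0 * p0 / 2) *: phi j) s|)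
  (fun s => (t0 * p0 / 2) * `|radsum n phi s|)); last first.
  move=> s _; rewrite -[t0 * p0 / 2]ger0_norm ?divr_ge0 ?mulr_ge0 ?ltW// -nZ.
  rewrite /radsum scaler_sumr; congr `|_|; apply: eq_bigr => j _.
  by rewrite ger0_norm ?divr_ge0 ?mulr_ge0 ?ltW// !scalerA mulrC.
rewrite avgZ => /le_trans/(_ alpha_avg) hh.
rewrite ler_pdivlMr ?mulr_gt0// mulrC.
lra.
Qed.

End Block.

(** * Orthonormal families and separability *)

Section Span.
Context (R : realType) (H : completeNormedModType R) (dot : {dot H for idfun}).

Inductive in_span (I : Type) (F : I -> H) : H -> Prop :=
| in_span0 : in_span F 0
| in_spanD x y : in_span F x -> in_span F y -> in_span F (x + y)
| in_spanZ (c : R) x : in_span F x -> in_span F (c *: x)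
| in_span_gen i : in_span F (F i).

Lemma in_spanB (I : Type) (F : I -> H) x y :
  in_span F x -> in_span F y -> in_span F (x - y).
Proof. by move=> hx hy; rewrite -scaleN1r; exact: in_spanD hx (in_spanZ _ hy). Qed.

Lemma in_span_sum (I : Type) (F : I -> H) (J : Type) (s : seq J) (p : pred J)
    (x : J -> H) : (forall j, p j -> in_span F (x j)) ->
  in_span F (\sum_(j <- s | p j) x j).
Proof.
move=> h; elim/big_rec : _ => [|j y pj]; first exact: in_span0.
exact: in_spanD (h j pj).
Qed.

Lemma in_span_trans (I J : Type) (F : I -> H) (G : J -> H) x :
  (forall i, in_span G (F i)) -> in_span F x -> in_span G x.
Proof.
move=> FG; elim=> {x} [|x y _ hx _ hy|c x _ hx|//].
- exact: in_span0.
- exact: in_spanD.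
- exact: in_spanZ.
Qed.

Lemma in_span_orthogonal (I : Type) (F : I -> H) x z :
  (forall i, dot (F i) z = 0) -> in_span F x -> dot x z = 0.
Proof.
move=> Fz; elim=> {x} [|x y _ hx _ hy|c x _ hx|//]; first exact: dot0l.
- by rewrite dotDl hx hy addr0.
- by rewrite dotZl hx mulr0.
Qed.

End Span.

(** * Bessel's inequality, projections and Gram-Schmidt *)

Section Hilbert.
Context (R : realType) (H : completeNormedModType R) (dot : {dot H for idfun}).
Hypothesis hdot : induces_norm dot.
Implicit Types (x y z : H).

Lemma dot_norm x : dot x x = `|x| ^+ 2.
Proof.
have h : 0 <= dot x x.
  have [->|x0] := eqVneq x 0; first by rewrite dot0l.
  by rewrite ltW//; exact: neq0_dnorm_gt0.
by rewrite hdot sqr_sqrtr.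
Qed.

(* Orthonormal up to the presence of zero vectors. *)
Definition partial_orthonormal (I : Type) (e : I -> H) : Prop :=
  (forall i j, i <> j -> dot (e i) (e j) = 0) /\
  (forall i, e i = 0 \/ dot (e i) (e i) = 1).

Section Bessel.
Context (e : nat -> H) (eON : partial_orthonormal e).

Definition partial_proj n x : H := \sum_(j < n) dot x (e j) *: e j.

Lemma dot_self_coef x j : dot x (e j) * dot (e j) (e j) = dot x (e j).
Proof.
by have [->|->] := eON.2 j; rewrite ?dot0r ?mulr1 ?mul0r.
Qed.

Lemma dot_partial_proj n x j :
  dot (partial_proj n x) (e j) = if (j < n)%N then dot x (e j) else 0.
Proof.
rewrite dot_suml; case: ifPn => [jn|jn].
  rewrite (bigD1 (Ordinal jn))//= dotZl dot_self_coef big1 ?addr0// => i ij.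
  rewrite dotZl eON.1 ?mulr0// => ij'; case/eqP: ij; exact: val_inj.
rewrite big1// => i _; rewrite dotZl eON.1 ?mulr0// => ij.
by move: jn; rewrite -ij ltn_ord.
Qed.

Lemma partial_proj_norm m n x : (m <= n)%N ->
  `|partial_proj n x - partial_proj m x| ^+ 2 =
  \sum_(m <= j < n) dot x (e j) ^+ 2.
Proof.
move=> mn; rewrite -dot_norm.
have E : partial_proj n x - partial_proj m x = \sum_(m <= j < n) dot x (e j) *: e j.
  rewrite /partial_proj -!(big_mkord xpredT (fun j => dot x (e j) *: e j)).
  by rewrite (big_cat_nat (leq0n m) mn)/= addrAC subrr add0r.
rewrite [X in dot _ X]E dot_sumr !big_nat; apply: eq_bigr => j /andP[mj jn].
by rewrite dotZr dotBl !dot_partial_proj jn ltnNge mj subr0 expr2.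
Qed.

Lemma bessel n x : \sum_(j < n) dot x (e j) ^+ 2 <= `|x| ^+ 2.
Proof.
have h0 : partial_proj 0 x = 0 by rewrite /partial_proj big_ord0.
have := partial_proj_norm x (leq0n n); rewrite h0 subr0 big_mkord => <-.
have : 0 <= `|x - partial_proj n x| ^+ 2 by exact: sqr_ge0.
rewrite -!dot_norm !dotBl !dotBr (dotC _ x (partial_proj n x)).
have -> : dot (partial_proj n x) x = dot (partial_proj n x) (partial_proj n x).
  rewrite {1 3}/partial_proj dot_suml dot_sumr; apply: eq_bigr => j _.
  by rewrite dotZl dotZr dot_partial_proj ltn_ord (dotC _ (e j)).
lra.
Qed.

Lemma normr_dot_le x j : `|dot x (e j)| <= `|x|.
Proof.
rewrite -ler_sqr ?nnegrE// real_normK ?num_real//.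
apply: le_trans (bessel j.+1 x); rewrite big_ord_recr /= lerDr.
by apply: sumr_ge0 => i _; exact: sqr_ge0.
Qed.

Lemma bessel_tail x (k : R) : 0 < k ->
  exists M : nat, forall m n, (M <= m)%N ->
    \sum_(j < n) dot x (e (m + j)) ^+ 2 < k.
Proof.
move=> k0; pose S n : R := \sum_(j < n) dot x (e j) ^+ 2.
have SD m n : S (m + n)%N = S m + \sum_(j < n) dot x (e (m + j)) ^+ 2.
  by rewrite /S big_split_ord.
have hS : has_sup (range S).
  by split; [exists (S 0%N), 0%N|exists (`|x| ^+ 2) => _ [n _ <-]; exact: bessel].
have [_ [M _ <-] SM] := sup_adherent k0 hS.
exists M => m n Mm.
have h1 : S (m + n)%N <= sup (range S) by apply: (sup_upper_bound hS); exists (m + n)%N.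
have h2 : S M <= S m.
  rewrite -(subnKC Mm) SD lerDl; apply: sumr_ge0 => j _; exact: sqr_ge0.
have := SD m n; lra.
Qed.

(** Bessel's inequality makes the partial projections Cauchy, and completeness supplies the limit
    [y], which lies in the closed span of [e]. *)
Lemma projection x : exists y,
  (forall eps : R, 0 < eps -> exists n, `|y - partial_proj n x| < eps) /\
  forall j, dot (x - y) (e j) = 0.
Proof.
pose s n := partial_proj n x.
have : cvg (s n @[n --> \oo]).
  apply/cauchy_cvgP/cauchyP => eps eps0.
  have [M hM] := bessel_tail x (exprn_gt0 2 eps0).
  exists (s M); exists M => // n /= Mn.
  rewrite -ball_normE /= -ltr_sqr ?nnegrE// ?ltW// distrC.
  rewrite partial_proj_norm// -{1}[M]add0n big_addn big_mkord.
  by under eq_bigr do rewrite addnC; exact: hM.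
move=> /cvg_ex[y /cvgrPdist_lt sy]; exists y; split.
  by move=> eps /sy/filter_ex[n ?]; exists n.
move=> j; apply/eqP; rewrite -normr_le0; apply/ler_addgt0Pr => eps eps0.
have [n /= [jn yn]] : exists n, (j < n)%N /\ `|y - s n| < eps.
  apply: (@filter_ex _ \oo%classic); near=> n; split; near: n; last exact: sy.
  exact: nbhs_infty_gt.
have -> : x - y = (x - s n) - (y - s n) by rewrite opprB addrA subrK.
rewrite dotBl dotBl dot_partial_proj jn subrr sub0r normrN add0r.
exact: le_trans (normr_dot_le _ _) (ltW yn).
Unshelve. all: by end_near. Qed.

End Bessel.

Definition normalize x : H := `|x|^-1 *: x.

Lemma dot_normalize x y : dot (normalize x) y = `|x|^-1 * dot x y.
Proof. exact: dotZl. Qed.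

Lemma normalize_norm x : normalize x = 0 \/ dot (normalize x) (normalize x) = 1.
Proof.
have [->|x0] := eqVneq x 0; [left|right]; first by rewrite /normalize scaler0.
by rewrite dotZl dotZr dot_norm; field; rewrite normr_eq0.
Qed.

Lemma gram_schmidt (y : nat -> H) : exists e : nat -> H,
  [/\ partial_orthonormal e, forall n, in_span y (e n) &
      forall n, in_span e (y n)].
Proof.
have [e eE] : exists e : nat -> H,
    forall n, e n = normalize (y n - \sum_(j < n) dot (y n) (e j) *: e j).
  (* Carrying the list of all earlier vectors makes the recursion structural. A dependent [y n]
     produces [normalize 0 = 0], whence the zero vectors in the family. *)
  pose step n s := normalize (y n - \sum_(v <- s) dot (y n) v *: v).
  pose gs := fix gs n : seq H := if n is m.+1 then rcons (gs m) (step m (gs m)) else [::].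
  have size_gs n : size (gs n) = n by elim: n => //= n IH; rewrite size_rcons IH.
  pose e n := step n (gs n).
  have gsE n : gs n = [seq e i | i <- iota 0 n].
    by elim: n => // n IH; rewrite -addn1 iotaD map_cat /= -IH addn1 /= cats1 add0n.
  exists e => n.
  rewrite {1}/e /step gsE big_map.
  by rewrite -(big_mkord xpredT (fun j => dot (y n) (e j) *: e j)) /index_iota subn0.
have e01 n : e n = 0 \/ dot (e n) (e n) = 1 by rewrite eE; exact: normalize_norm.
have orth n i : (i < n)%N -> dot (e n) (e i) = 0.
  elim/ltn_ind: n i => n IH i iN.
  rewrite {1}eE dot_normalize dotBl dot_suml.
  suff -> : \sum_(j < n) dot (dot (y n) (e j) *: e j) (e i) = dot (y n) (e i).
    by rewrite subrr mulr0.
  rewrite (bigD1 (Ordinal iN))//= dotZl big1 => [|j ji].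
    by rewrite addr0; case: (e01 i) => [->|->]; rewrite ?dot0r ?mulr1 ?mul0r.
  rewrite dotZl; have [jlt|ilt|jE] := ltngtP j i.
  - by rewrite dotC IH ?mulr0.
  - by rewrite IH ?mulr0.
  - by case/eqP: ji; exact: val_inj.
exists e; split.
- split=> // i j ij; have [lt|lt|//] := ltngtP i j; last exact: orth.
  by rewrite dotC; exact: orth.
- elim/ltn_ind => n IH; rewrite eE; apply: in_spanZ; apply: in_spanB.
    exact: in_span_gen.
  by apply: in_span_sum => j _; apply: in_spanZ; exact: IH.
- move=> n; set z := y n - \sum_(j < n) dot (y n) (e j) *: e j.
  have -> : y n = `|z| *: e n + \sum_(j < n) dot (y n) (e j) *: e j.
    rewrite eE /normalize -/z scalerA.
    have [z0|z0] := eqVneq z 0; last by rewrite mulfV ?normr_eq0// scale1r subrK.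
    by rewrite z0 scaler0 add0r; apply/eqP; rewrite -subr_eq0 -/z z0.
  apply: in_spanD; first by apply: in_spanZ; exact: in_span_gen.
  by apply: in_span_sum => j _; apply: in_spanZ; exact: in_span_gen.
Qed.

End Hilbert.

Section Separability.
Context (R : realType) (H : completeNormedModType R).

Lemma separable_dense_seq : separable H ->
  exists x : nat -> H, forall z (eps : R), 0 < eps -> exists i, `|z - x i| < eps.
Proof.
move=> [D cD dD].
have near z (eps : R) : 0 < eps -> exists2 v, D v & `|z - v| < eps.
  move=> eps0; have [|v [zv Dv]] := dD (ball z eps) _ (ball_open z eps).
    by exists z; exact: ballxx.
  by exists v => //; move: zv; rewrite -ball_normE.
have [v0 Dv0 _] := near 0 1 ltr01.
have /pfcard_geP [D0|] := cD.
  by move: Dv0; rewrite D0.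
move=> [f]; exists f => z eps eps0; have [v Dv zv] := near z eps eps0.
have [i _ fi] : range f v by apply: (@surj _ _ _ _ f).
by exists i; rewrite fi.
Qed.

(** A subset of a separable metric space is separable: each ball of radius [k.+1%:R^-1] about a
    dense point that meets the range of [rho] contributes one value, within twice that radius of
    every other value in the ball. *)
Lemma separable_range (U : Type) (u0 : U) (rho : U -> H) : separable H ->
  exists v : nat -> U, forall u (eps : R), 0 < eps ->
    exists i, `|rho u - rho (v i)| < eps.
Proof.
move=> /separable_dense_seq[x hx].
have pick (ik : nat * nat) : exists v, (exists u, `|x ik.1 - rho u| < ik.2.+1%:R^-1) ->
    `|x ik.1 - rho v| < ik.2.+1%:R^-1.
  have [[u hu]|no] := pselect (exists u, `|x ik.1 - rho u| < ik.2.+1%:R^-1).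
    by exists u.
  by exists u0.
have [v hv] := choice pick.
exists (fun n => v (odflt (0%N, 0%N) (unpickle n))) => u eps eps0.
have eps20 : 0 < eps / 2 by rewrite divr_gt0.
have [k _ /(_ k (leqnn k)) /= hk] := near_infty_natSinv_lt (PosNum eps20).
have k0 : 0 < k.+1%:R^-1 :> R by rewrite invr_gt0.
have [i hi] := hx (rho u) _ k0.
exists (pickle (i, k)); rewrite pickleK /=.
have h : `|x i - rho (v (i, k))| < k.+1%:R^-1.
  by apply: (hv (i, k)); exists u; rewrite distrC.
have -> : rho u - rho (v (i, k)) = (rho u - x i) + (x i - rho (v (i, k))).
  by rewrite addrA subrK.
rewrite (le_lt_trans (ler_normD _ _))// [eps]splitr ltrD//.
- exact: lt_trans hi hk.
- exact: lt_trans h hk.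
Qed.

End Separability.

(** * Walsh rotation of blocks *)

Section WalshRotation.
Context (R : realType) (H : completeNormedModType R) (dot : {dot H for idfun}).
Context (a : nat) (e : nat -> H) (s : seq bool).
Local Notation n := (2 ^ a)%N.
Hypothesis eON : forall i j, (i < n)%N -> (j < n)%N -> dot (e i) (e j) = (i == j)%:R.

(** The value 0 past [2 ^ a] lets blocks of all lengths be indexed by [nat]. *)
Definition walsh_rotation k : H :=
  if (k < n)%N then (Num.sqrt n%:R)^-1 *:
    \sum_(j < n) (sg R (walsh a k j) * sg R (nth false s j)) *: e j
  else 0.

Let n0 : 0 < n%:R :> R.
Proof. by rewrite ltr0n expn_gt0. Qed.

Let sqrtn : (Num.sqrt n%:R)^-1 * (Num.sqrt n%:R)^-1 = n%:R^-1 :> R.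
Proof. by rewrite -invfM -expr2 sqr_sqrtr// ltW. Qed.

Let sg2 b : sg R b * sg R b = 1.
Proof. by case: b; rewrite /sg ?mulr1 ?mulrNN ?mulr1. Qed.

Lemma walsh_rotation_orthonormal : partial_orthonormal dot walsh_rotation.
Proof.
have h k l : (k < n)%N -> (l < n)%N ->
    dot (walsh_rotation k) (walsh_rotation l) = (k == l)%:R.
  move=> kn ln; rewrite /walsh_rotation kn ln dotZl dotZr mulrA sqrtn dot_suml.
  have -> : \sum_(i < n) dot ((sg R (walsh a k i) * sg R (nth false s i)) *: e i)
      (\sum_(j < n) (sg R (walsh a l j) * sg R (nth false s j)) *: e j) =
    \sum_(i < n) sg R (walsh a k i) * sg R (walsh a l i).
    apply: eq_bigr => i _; rewrite dotZl dot_sumr (bigD1 i)//= big1 => [|j ji].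
      rewrite addr0 dotZr eON// eqxx.
      rewrite (_ : true%:R = 1 :> R)// mulr1 mulrACA sg2 mulr1 //.
    by rewrite dotZr eON// eq_sym (val_eqE j i) (negbTE ji) mulr0.
  by rewrite walsh_orthogonal// mulrA mulVf ?mul1r// gt_eqF.
split=> [k l kl|k].
  have [kn|kn] := ltnP k n; last by rewrite /walsh_rotation ltnNge kn dot0l.
  have [ln|ln] := ltnP l n; last by rewrite {2}/walsh_rotation (ltnNge l) ln dot0r.
  by rewrite h//; case: eqP.
have [kn|kn] := ltnP k n; last by left; rewrite /walsh_rotation ltnNge kn.
by right; rewrite h// eqxx.
Qed.

Lemma walsh_rotation_span k : in_span (fun j : 'I_n => e j) (walsh_rotation k).
Proof.
rewrite /walsh_rotation; case: ifP => _; last exact: in_span0.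
apply: in_spanZ; apply: in_span_sum => j _; apply: in_spanZ.
exact: (in_span_gen (fun j : 'I_n => e j)).
Qed.

(** The transposed matrix inverts the rotation; its columns are orthogonal because [walsh] is
    symmetric. *)
Lemma span_walsh_rotation j : (j < n)%N -> in_span walsh_rotation (e j).
Proof.
move=> jn.
have -> : e j = \sum_(k < n) ((Num.sqrt n%:R)^-1 *
    (sg R (walsh a k j) * sg R (nth false s j))) *: walsh_rotation k.
  have -> : \sum_(k < n) ((Num.sqrt n%:R)^-1 *
      (sg R (walsh a k j) * sg R (nth false s j))) *: walsh_rotation k =
    \sum_(k < n) \sum_(i < n) (n%:R^-1 * (sg R (nth false s j) * sg R (nth false s i)) *
       (sg R (walsh a j k) * sg R (walsh a i k))) *: e i.
    apply: eq_bigr => k _; rewrite /walsh_rotation ltn_ord scalerA scaler_sumr.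
    apply: eq_bigr => i _; rewrite scalerA; congr (_ *: _).
    by rewrite -sqrtn (walshC a j k) (walshC a i k); ring.
  rewrite exchange_big /= (bigD1 (Ordinal jn))//= [X in _ + X]big1 => [|i ij].
    rewrite addr0 -scaler_suml -mulr_sumr walsh_orthogonal// eqxx sg2.
    by rewrite (_ : true%:R = 1 :> R)// !mulr1 mulVf ?scale1r// gt_eqF.
  rewrite -scaler_suml -mulr_sumr walsh_orthogonal//.
  rewrite (_ : (j == i :> nat) = false) ?mulr0 ?scale0r//.
  by apply/negbTE; apply: contra ij => /eqP ji; apply/eqP; exact: val_inj.
by apply: in_span_sum => k _; apply: in_spanZ; exact: in_span_gen.
Qed.

End WalshRotation.

(** * Orthonormal rows with summable suprema *)

Section Rows.
Context (R : realType) (H : completeNormedModType R) (dot : {dot H for idfun}).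
Hypothesis hdot : induces_norm dot.
Context (d : nat) (rho : 'rV[R]_d -> H).
Context (disp : measure_display) (T : measurableType disp) (P : probability T R).
Context (zeta : 'rV[R]_d -> {RV P >-> R}).
Hypothesis hgauss : gaussian_field zeta.
Hypothesis hcentered : centered_field zeta.
Hypothesis hcov : forall u v,
  ('E_P[zeta u \* zeta v] = (dot (rho u) (rho v))%:E)%E.
Local Notation U := 'rV[R]_d.
Hypothesis osc : forall e0 delta : R, 0 < e0 -> 0 < delta ->
  exists (N : seq U) (p : U -> U), (forall u, p u \in N) /\
    forall r (u : 'I_r -> U),
      ((1 - delta)%:E <=
       P [set w | forall i, `|zeta (u i) w - zeta (p (u i)) w| < e0]%R)%E.

(* [sum_k sup_u (rho u, e k)^2 <= B]. *)
Definition sum_sup_le (e : nat -> H) (B : R) : Prop :=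
  forall (v : nat -> U) m, \sum_(k < m) dot (rho (v k)) (e k) ^+ 2 <= B.

(* Each Walsh row has entries [+-1], so every coordinate [(rho u, e'_k)] of the
   rotated family is [2^(-a/2)] times a signed sum [sum_j +-phi_j u]; averaging
   over the signs [s] gives the same bound for all [2^a] rows at once. *)
Lemma rotate_block : exists (c delta : R), [/\ 0 < c, 0 < delta &
  forall eta : R, 0 < eta -> exists N : seq U, forall (K : R) a (e : nat -> H) (g : nat -> T -> R),
    0 < K ->
    (forall i j, (i < 2 ^ a)%N -> (j < 2 ^ a)%N -> dot (e i) (e j) = (i == j)%:R) ->
    (forall j, (j < 2 ^ a)%N -> represents rho zeta (g j) (e j)) ->
    \sum_(q <- N) \sum_(j < 2 ^ a) dot (rho q) (e j) ^+ 2 <= delta * K ^+ 2 ->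
    exists s, sum_sup_le (walsh_rotation a e s) (c * (eta + K) ^+ 2)].
Proof.
have [t0 t00 [p0 p00 tail]] := unit_represents_tail hgauss hcentered hcov.
(* [6 / (t0 * p0)] and [p0 / 48] come from [block_average], the factor 2 from [kahane]. *)
exists (2 * (6 / (t0 * p0)) ^+ 2), (p0 / 48); split.
- by rewrite mulr_gt0// exprn_gt0// divr_gt0// mulr_gt0.
- by rewrite divr_gt0.
move=> eta eta0; have [|N [p [pN hN]]] := osc eta0 (_ : 0 < p0 / 48).
  by rewrite divr_gt0.
exists N => K a e g K0 eON ge var.
set n := (2 ^ a)%N in eON ge var *.
set B := 2 * _ * _.
apply: contrapT => /forallNP noS.
have bad (t : n.-tuple bool) : exists v : nat -> U,
    B < \sum_(k < n) dot (rho (v k)) (walsh_rotation a e t k) ^+ 2.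
  have /existsNP[v /existsNP[m /negP]] := noS t.
  rewrite -ltNge => h; exists v; apply: lt_le_trans h _.
  pose f k := dot (rho (v k)) (walsh_rotation a e t k) ^+ 2.
  (* Rows from [n] on vanish, so a failure for any [m] is a failure for [m = n]. *)
  apply: (@le_trans _ _ (\sum_(k < m + n) f k)).
    by rewrite big_split_ord /= lerDl; apply: sumr_ge0 => k _; exact: sqr_ge0.
  rewrite addnC big_split_ord /= [X in _ + X]big1 ?addr0// => k _.
  by rewrite /f /walsh_rotation ltnNge leq_addr /= dot0r expr0n.
have [v hv] := choice bad.
(* The failing points depend on the sign pattern, which is chosen only after averaging; hence the
   points of all patterns and all rows enter one finite family. *)
pose I := (n.-tuple bool * 'I_n)%type.
pose u (i : 'I_#|{: I}|) : U := v (enum_val i).1 (enum_val i).2.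
pose phi j : 'rV[R]_#|{: I}| := \row_i dot (rho (u i)) (e j).
have avg1 : avg n (fun s => `|radsum n phi s|) <= 6 * (eta + K) / (t0 * p0).
  apply: (block_average hgauss hcentered hcov eON ge eta0 K0 pN hN var) => //.
  by move=> j jn; apply: tail (ge j jn) _; rewrite eON// eqxx.
have nD (x y : 'rV[R]_#|{: I}|) : `|x + y| <= `|x| + `|y| by exact: ler_normD.
have nZ c (x : 'rV[R]_#|{: I}|) : `|c *: x| = `|c| * `|x| by exact: normrZ.
have avg2 : avg n (fun s => `|radsum n phi s| ^+ 2) <= B.
  apply: le_trans (kahane nD nZ n phi) _.
  have -> : B = 2 * (6 * (eta + K) / (t0 * p0)) ^+ 2 by rewrite /B; field; rewrite !gt_eqF.
  rewrite ler_pM2l// ler_pXn2r// ?nnegrE; first by apply: avg_ge0 => s _.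
  by rewrite divr_ge0// ?mulr_ge0 ?addr_ge0// ltW.
have [s ss] := avg_attained n (fun s => \sum_(k < n)
  `|radsum n (fun j => sg R (walsh a k j) *: phi j) s| ^+ 2).
rewrite (avg_walsh (fun x : 'rV[R]_#|{: I}| => `|x| ^+ 2)) => sle.
have ts : size s == n by rewrite ss.
have n0 : 0 < n%:R :> R by rewrite ltr0n expn_gt0.
have : n%:R * \sum_(k < n) dot (rho (v (Tuple ts) k)) (walsh_rotation a e s k) ^+ 2 <= n%:R * B.
  apply: le_trans (_ : n%:R * avg n (fun s => `|radsum n phi s| ^+ 2) <= _); last first.
    by rewrite ler_pM2l.
  apply: le_trans sle; rewrite mulr_sumr; apply: ler_sum => k _.
  set x := radsum _ _ _.
  have -> : n%:R * dot (rho (v (Tuple ts) k)) (walsh_rotation a e s k) ^+ 2 =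
      x ord0 (enum_rank ((Tuple ts, k) : I)) ^+ 2.
    rewrite -[n%:R]sqr_sqrtr ?(ltW n0)// -exprMn; congr (_ ^+ 2).
    rewrite /walsh_rotation ltn_ord dotZr mulrA mulfV; last first.
      by rewrite sqrtr_eq0 -ltNge.
    rewrite mul1r dot_sumr /x /radsum summxE; apply: eq_bigr => j _.
    by rewrite !mxE dotZr /u enum_rankK /=; ring.
  rewrite -[leLHS]real_normK ?num_real// ler_pXn2r// ?nnegrE//.
  exact: ler_coord_norm.
rewrite ler_pM2l// leNgt => /negP; apply.
exact: hv (Tuple ts).
Qed.

(** The condition on the net can always be met by enlarging [K]. This serves the first block and the
    blocks of length 1 of the finite case. *)
Lemma some_block a (e : nat -> H) (g : nat -> T -> R) :
  (forall i j, (i < 2 ^ a)%N -> (j < 2 ^ a)%N -> dot (e i) (e j) = (i == j)%:R) ->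
  (forall j, (j < 2 ^ a)%N -> represents rho zeta (g j) (e j)) ->
  exists s B, sum_sup_le (walsh_rotation a e s) B.
Proof.
move=> eON ge; have [c [delta [c0 delta0 /(_ 1 ltr01)[N h]]]] := rotate_block.
set V := \sum_(q <- N) \sum_(j < 2 ^ a) dot (rho q) (e j) ^+ 2.
have V0 : 0 <= V by apply: sumr_ge0 => q _; apply: sumr_ge0 => j _; exact: sqr_ge0.
have K1 : 1 <= 1 + V / delta by rewrite lerDl divr_ge0// ltW.
have K0 : 0 < 1 + V / delta by exact: lt_le_trans K1.
have [|s hs] := h _ a e g K0 eON ge; last by exists s; eexists; exact: hs.
have -> : delta * (1 + V / delta) ^+ 2 = (delta + V) * (1 + V / delta).
  by field; rewrite gt_eqF.
rewrite -/V -[leLHS]mulr1; apply: ler_pM => //; lra.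
Qed.

Lemma bessel_tail_seq (e : nat -> H) (N : seq U) (k : R) :
  partial_orthonormal dot e -> 0 < k ->
  exists M : nat, forall m n, (M <= m)%N ->
    \sum_(q <- N) \sum_(j < n) dot (rho q) (e (m + j)%N) ^+ 2 <= k.
Proof.
move=> eON; elim: N k => [|q N IH] k k0.
  by exists 0%N => m n _; rewrite big_nil ltW.
have k20 : 0 < k / 2 by rewrite divr_gt0.
have [M1 h1] := IH _ k20; have [M2 h2] := bessel_tail hdot eON (rho q) k20.
exists (maxn M1 M2) => m n; rewrite geq_max => /andP[/h1 l1 /h2 l2].
rewrite big_cons [k]splitr; apply: lerD; [exact: ltW (l2 n)|exact: l1].
Qed.

Lemma small_blocks (e : nat -> H) (g : nat -> T -> R) (b : R) :
  (forall i j, dot (e i) (e j) = (i == j)%:R) ->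
  (forall j, represents rho zeta (g j) (e j)) -> 0 < b ->
  exists M : nat, forall m a, (M <= m)%N ->
    exists s, sum_sup_le (walsh_rotation a (fun j => e (m + j)%N) s) b.
Proof.
move=> eON ge b0; have [c [delta [c0 delta0 h]]] := rotate_block.
(* With [eta = K = r] the bound [c * (eta + K) ^+ 2] becomes [4 * c * r ^+ 2 = b]. *)
have r20 : 0 < b / (4 * c) by rewrite divr_gt0// mulr_gt0.
set r := Num.sqrt (b / (4 * c)); have r0 : 0 < r by rewrite sqrtr_gt0.
have r2E : r ^+ 2 = b / (4 * c) by rewrite sqr_sqrtr// ltW.
have [N hN] := h r r0.
have pON : partial_orthonormal dot e.
  split=> [i j ij|i]; rewrite eON; last by right; rewrite eqxx.
  by case: eqP.
have [M hM] := @bessel_tail_seq e N (delta * r ^+ 2) pON (mulr_gt0 delta0 (exprn_gt0 2 r0)).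
exists M => m a Mm.
have [|j _||s hs] := hN r a (fun j => e (m + j)%N) (fun j => g (m + j)%N) r0.
- by move=> i j _ _; rewrite eON eqn_add2l.
- exact: ge.
- exact: hM.
exists s; have -> : b = c * (r + r) ^+ 2 => //.
have -> : c * (r + r) ^+ 2 = 4 * c * r ^+ 2 by ring.
by rewrite r2E; field; rewrite gt_eqF.
Qed.

Definition pairs (w : nat -> nat -> H) (p : nat * nat) : H := w p.1 p.2.

(* An orthonormal family [w k i], arranged in rows, with the same span as [e]
   and with summable squared suprema. *)
Definition good_rows (e : nat -> H) (w : nat -> nat -> H) (B : nat -> R) : Prop :=
  [/\ partial_orthonormal dot (pairs w), forall k i, in_span e (w k i),
      forall m, in_span (pairs w) (e m), forall k, sum_sup_le (w k) (B k) &
      exists C, forall M, \sum_(k < M) B k <= C].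

Lemma rows_orthonormal (w : nat -> nat -> H) :
  (forall k, partial_orthonormal dot (w k)) ->
  (forall k l i j, (k < l)%N -> dot (w k i) (w l j) = 0) ->
  partial_orthonormal dot (pairs w).
Proof.
move=> wk wkl; split=> [[k i] [l j] kl|[k i]]; last exact: (wk k).2.
rewrite /pairs /=; have [lt|lt|E] := ltngtP k l.
- exact: wkl.
- by rewrite dotC wkl.
- by rewrite E; apply: (wk l).1 => ij; apply: kl; rewrite E ij.
Qed.

Lemma rows_infinite (e : nat -> H) (g : nat -> T -> R) :
  (forall i j, dot (e i) (e j) = (i == j)%:R) ->
  (forall j, represents rho zeta (g j) (e j)) ->
  exists w B, good_rows e w B.
Proof.
move=> eON ge.
have b0 k : 0 < (2^-1 : R) ^+ k by rewrite exprn_gt0.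
have [M hM] := choice (fun k => small_blocks eON ge (b0 k)).
(* Block [k] starts at [st k] and has length [2 ^ M k]; hence block [k.+1] starts beyond [M k], far
   enough for the bound [2^-1 ^+ k]. *)
pose st := fix st k := if k is l.+1 then (st l + 2 ^ M l)%N else 0%N.
have [s0 [B0 h0]] : exists s B, sum_sup_le (walsh_rotation (M 0%N) e s) B.
  by apply: (@some_block _ e g) => [i j _ _|j _]; [exact: eON|exact: ge].
have st_ge k : (M k <= st k.+1)%N.
  by rewrite /= (leq_trans (ltnW (ltn_expl _ (ltnSn 1))))// leq_addl.
have [s hs] := choice (fun k => hM k (st k.+1) (M k.+1) (st_ge k)).
pose ss k := if k is l.+1 then s l else s0.
pose w k := walsh_rotation (M k) (fun j => e (st k + j)%N) (ss k).
pose B k : R := if k is l.+1 then 2^-1 ^+ l else B0.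
have wspan k i : in_span (fun j : 'I_(2 ^ M k) => e (st k + j)%N) (w k i).
  exact: walsh_rotation_span.
have shON k i j : dot (e (st k + i)%N) (e (st k + j)%N) = (i == j)%:R.
  by rewrite eON eqn_add2l.
have st_lt k l : (k < l)%N -> (st k + 2 ^ M k <= st l)%N.
  elim: l => // l IH; rewrite ltnS leq_eqVlt => /orP[/eqP->//|/IH h].
  by rewrite (leq_trans h)//= leq_addr.
exists w, B; split.
- apply: rows_orthonormal => [k|k l i j kl].
    by apply: walsh_rotation_orthonormal => i j _ _; exact: shON.
  apply: in_span_orthogonal (wspan k i) => i'.
  rewrite dotC; apply: in_span_orthogonal (wspan l j) => j'.
  rewrite eON; case: eqP => // E.
  have := st_lt k l kl; rewrite leqNgt => /negP[].
  by rewrite (@leq_ltn_trans (st l + j')%N) ?leq_addr// E ltn_add2l.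
- move=> k i; apply: in_span_trans (wspan k i) => j; exact: in_span_gen.
- move=> m.
  have [k [i [ik ->]]] : exists k i, (i < 2 ^ M k)%N /\ m = (st k + i)%N.
    elim: m => [|m [k [i [ik ->]]]]; first by exists 0%N, 0%N; rewrite expn_gt0.
    have [lt|ge'] := ltnP i.+1 (2 ^ M k); first by exists k, i.+1; rewrite addnS.
    exists k.+1, 0%N; rewrite expn_gt0; split=> //=.
    by rewrite addn0 -addnS; congr (_ + _)%N; apply/eqP; rewrite eqn_leq ge' andbT.
  have h : in_span (w k) (e (st k + i)%N).
    exact: (@span_walsh_rotation _ _ (M k) (fun j => e (st k + j)%N) (ss k) i ik).
  by apply: in_span_trans h => j; exact: (in_span_gen (pairs w) (k, j)).
- by case=> [|k]; [exact: h0|exact: hs].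
- exists (`|B0| + 2) => m.
  have : \sum_(k < m) B k <= `|B0| + \sum_(k < m) 2^-1 ^+ k.
    case: m => [|m]; first by rewrite !big_ord0 addr0.
    rewrite big_ord_recl /= lerD ?ler_norm//.
    by rewrite [leRHS]big_ord_recr /= lerDl exprn_ge0.
  move=> /le_trans; apply; rewrite lerD2l.
  have -> : \sum_(k < m) 2^-1 ^+ k = 2 - 2 * 2^-1 ^+ m :> R.
    elim: m => [|m IH]; first by rewrite big_ord0 expr0; ring.
    by rewrite big_ord_recr /= IH exprS; field.
  by rewrite gerBl mulr_ge0// ltW.
Qed.

Lemma rows_finite (e : nat -> H) (g : nat -> T -> R) (N : nat) :
  partial_orthonormal dot e -> (forall j, represents rho zeta (g j) (e j)) ->
  (forall j, (N <= j)%N -> e j = 0) -> exists w B, good_rows e w B.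
Proof.
move=> eON ge eN.
(* Each vector forms a block of length 1. The last clause gives zero vectors the bound 0, so that
   only finitely many bounds contribute. *)
have row k : exists w : nat -> H, exists b : R,
    [/\ partial_orthonormal dot w, forall i, in_span (fun _ : unit => e k) (w i),
        in_span w (e k), sum_sup_le w b & e k = 0 -> b = 0].
  have [e0|ek1] := eON.2 k.
    exists (fun=> 0), 0; split=> //.
    - by split=> [i j _|i]; [rewrite dot0l|left].
    - by move=> i; exact: in_span0.
    - by rewrite e0; exact: in_span0.
    - by move=> v m; rewrite big1// => i _; rewrite dot0r expr0n.
  have ON1 i j : (i < 2 ^ 0)%N -> (j < 2 ^ 0)%N -> dot (e k) (e k) = (i == j)%:R.
    by case: i => //; case: j => // _ _; rewrite ek1.
  have [s [b hb]] := @some_block 0 (fun=> e k) (fun=> g k) ON1 (fun _ _ => ge k).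
  exists (walsh_rotation 0 (fun=> e k) s), b; split=> //.
  - exact: walsh_rotation_orthonormal.
  - move=> i; apply: in_span_trans (walsh_rotation_span _ _ _ i) => j.
    exact: (in_span_gen (fun _ : unit => e k) tt).
  - exact: (@span_walsh_rotation _ _ 0 (fun=> e k) s 0%N).
  - by move=> ek0; move: ek1; rewrite ek0 dot0l => /esym/eqP; rewrite oner_eq0.
have [w {}row] := choice row; have [B {}row] := choice row.
exists w, B; split.
- apply: rows_orthonormal => [k|k l i j kl]; first by have [] := row k.
  have [_ hk _ _ _] := row k; have [_ hl _ _ _] := row l.
  apply: in_span_orthogonal (hk i) => _; rewrite dotC.
  apply: in_span_orthogonal (hl j) => _; apply: eON.1 => E.
  by move: kl; rewrite E ltnn.
- move=> k i; have [_ hk _ _ _] := row k.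
  by apply: in_span_trans (hk i) => _; exact: in_span_gen.
- move=> k; have [_ _ hk _ _] := row k.
  by apply: in_span_trans hk => i; exact: (in_span_gen (pairs w) (k, i)).
- by move=> k; have [] := row k.
- exists (\sum_(k < N) `|B k|) => M.
  apply: (@le_trans _ _ (\sum_(k < N + M) `|B k|)).
    rewrite addnC big_split_ord /= -[leLHS]addr0; apply: lerD.
      by apply: ler_sum => k _; exact: ler_norm.
    by apply: sumr_ge0 => k _; exact: normr_ge0.
  rewrite big_split_ord /= [X in _ + X]big1 ?addr0// => k _.
  by have [_ _ _ _ ->] := row (N + k)%N; rewrite ?normr0// eN// leq_addr.
Qed.

Lemma rows_exist (e : nat -> H) (g : nat -> T -> R) :
  partial_orthonormal dot e -> (forall j, represents rho zeta (g j) (e j)) ->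
  exists w B, good_rows e w B.
Proof.
move=> eON ge.
have [[N eN]|unb] := pselect (exists N, forall j, (N <= j)%N -> e j = 0).
  exact: rows_finite eON ge eN.
have inf : infinite_set [set j | e j != 0].
  move=> /finite_fsetP[X XE]; apply: unb.
  exists (\max_(i <- finmap.enum_fset X) i).+1 => j hj; apply/eqP; apply: contraT => ej.
  have jX : j \in finmap.enum_fset X by have : [set j | e j != 0] j by []; rewrite XE.
  by move: hj; rewrite ltnNge (@leq_bigmax_seq _ _ xpredT (fun i => i)).
have : ([set: nat] #= [set j | e j != 0])%card.
  rewrite card_eq_le; apply/andP; split; first exact/infiniteP.
  exact: countableP.
move=> /card_set_bijP[nu [nuJ nu_inj nu_surj]].
have fON i j : dot (e (nu i)) (e (nu j)) = (i == j)%:R.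
  case: eqP => [->|ij]; last by apply: eON.1 => E; apply: ij; apply: nu_inj E; rewrite inE.
  have [E|//] := eON.2 (nu j).
  by have := nuJ j I; rewrite /= E eqxx.
have [w [B [h1 h2 h3 h4 h5]]] := rows_infinite fON (fun j => ge (nu j)).
exists w, B; split=> //.
- by move=> k i; apply: in_span_trans (h2 k i) => j; exact: in_span_gen.
- move=> m; have [->|em] := eqVneq (e m) 0; first exact: in_span0.
  by have [j _ <-] := nu_surj m em; exact: h3.
Qed.

End Rows.

(** * Summation over the basis *)

Section Assembly.
Context (R : realType) (H : completeNormedModType R) (dot : {dot H for idfun}).
Context (U : Type) (u0 : U).

(** Suprema are taken one term at a time: with the head evaluated at [u], the remaining sum of
    suprema is at most [C - F i u] by induction, and then [u] varies. *)
Lemma sum_ereal_sup_le (I : eqType) (s : seq I) (F : I -> U -> R) (C : R) :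
  uniq s -> (forall i u, 0 <= F i u) ->
  (forall v : I -> U, \sum_(i <- s) F i (v i) <= C) ->
  (\sum_(i <- s) ereal_sup [set (F i u)%:E | u in [set: U]] <= C%:E)%E.
Proof.
move=> + F0; elim: s C => [|i s IH] C.
  by move=> _ /(_ (fun=> u0)); rewrite !big_nil lee_fin.
move=> /= /andP[nis us] hC; rewrite big_cons.
set X := (\sum_(j <- s) _)%E.
have XC u : (X <= (C - F i u)%:E)%E.
  apply: IH => // v; rewrite lerBrDl.
  have := hC (fun j => if j == i then u else v j).
  rewrite big_cons eqxx (eq_big_seq (fun j => F j (v j)))// => j js.
  by case: eqP => // ji; move: nis; rewrite -ji js.
have X0 : (0 <= X)%E.
  apply: sume_ge0 => j _; apply: ereal_sup_ge; exists (F j u0)%:E; first by exists u0.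
  by rewrite lee_fin.
have Xfin : X \is a fin_num.
  by rewrite ge0_fin_numE// (le_lt_trans (XC u0))// ltry.
rewrite -leeBrDr//; apply: ge_ereal_sup => _ [u _ <-].
rewrite leeBrDr// addeC -leeBrDr//; exact: XC.
Qed.

Lemma ler_sum_uniq_sub (I : eqType) (L L' : seq I) (F : I -> R) :
  uniq L -> uniq L' -> {subset L <= L'} -> (forall i, 0 <= F i) ->
  \sum_(i <- L) F i <= \sum_(i <- L') F i.
Proof.
move=> uL uL' LL' F0.
have p : perm_eq L [seq i <- L' | i \in L].
  apply: uniq_perm => //; first exact: filter_uniq.
  move=> i; rewrite mem_filter; case: (boolP (i \in L)) => //= iL.
  by rewrite LL'.
rewrite (perm_big _ p) big_filter big_mkcond /=; apply: ler_sum => i _.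
by case: ifP.
Qed.

End Assembly.

Section Compress.
Context (R : realType) (H : completeNormedModType R) (dot : {dot H for idfun}).
Context (d : nat) (rho : 'rV[R]_d -> H).
Local Notation U := 'rV[R]_d.

Lemma pairs_sum_le (W : nat -> nat -> H) (B : nat -> R) (C : R) :
  (forall k, sum_sup_le dot rho (W k) (B k)) -> (forall M, \sum_(k < M) B k <= C) ->
  forall (L : seq (nat * nat)) (v : nat * nat -> U), uniq L ->
    \sum_(p <- L) dot (rho (v p)) (pairs W p) ^+ 2 <= C.
Proof.
move=> WB BC L v uL.
pose M := (\max_(p <- L) maxn p.1 p.2).+1.
apply: le_trans (BC M).
have ltM p : p \in L -> (p.1 < M)%N && (p.2 < M)%N.
  by move=> pL; rewrite -gtn_max ltnS (@leq_bigmax_seq _ _ xpredT (fun p => maxn p.1 p.2)).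
pose L' := [seq (k, i) | k <- iota 0 M, i <- iota 0 M].
apply: le_trans (@ler_sum_uniq_sub _ _ L L' _ uL _ _ _) _.
- by apply: allpairs_uniq; rewrite ?iota_uniq// => -[? ?] [? ?] _ _ [-> ->].
- move=> [k i] /ltM /andP[kM iM]; apply/allpairsP; exists (k, i).
  by split=> //; rewrite mem_iota.
- by move=> p; exact: sqr_ge0.
rewrite big_allpairs -[iota 0 M]/(index_iota 0 M) big_mkord.
apply: ler_sum => k _; rewrite big_mkord.
exact: (WB k (fun i => v (nat_of_ord k, i))).
Qed.

(** Discarding the zero vectors changes neither the span nor the sums; the others are renumbered by
    the index set that [orthonormal_basis] asks for. *)
Lemma compress (A : nat * nat -> H) (C : R) :
  partial_orthonormal dot A ->
  (forall x (eps : R), 0 < eps -> exists2 y, in_span A y & `|x - y| < eps) ->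
  (forall (L : seq (nat * nat)) (v : nat * nat -> U), uniq L ->
    \sum_(p <- L) dot (rho (v p)) (A p) ^+ 2 <= C) ->
  exists (I : set nat) (e : nat -> H),
    orthonormal_basis dot I e /\
    (\sum_(0 <= m <oo | m \in I)
       ereal_sup [set ((dot (rho u) (e m)) ^+ 2)%:E | u in [set: 'rV[R]_d]]
     < +oo)%E.
Proof.
move=> AON Adense AC.
pose J := [set p | A p != 0].
have [I [I_form IJ]] : exists I : set nat,
    (I = setT \/ exists n, I = `I_n) /\ (I #= J)%card.
  have [/finite_setP[n Jn]|inf] := pselect (finite_set J).
    by exists `I_n; split; [right; exists n|exact: card_esym].
  exists setT; split; first by left.
  by rewrite card_eq_le; apply/andP; split; [exact/infiniteP|exact: countableP].
have /card_set_bijP[nu [nuJ nu_inj nu_surj]] := IJ.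
exists I, (A \o nu); split.
  split=> //.
    move=> i j Ii Ij; rewrite /=; case: eqP => [->|ij].
      by have [E|//] := AON.2 (nu j); have := nuJ j Ij; rewrite /J /= E eqxx.
    by apply: AON.1 => E; apply: ij; apply: nu_inj E; rewrite inE.
  set S := [set x | _].
  have pad n m (c : nat -> R) : \sum_(0 <= i < n | i \in I) c i *: (A \o nu) i =
     \sum_(0 <= i < n + m | i \in I) (if (i < n)%N then c i else 0) *: (A \o nu) i.
    rewrite (@big_cat_nat _ _ _ n 0 (n + m))//= ?leq_addr//.
    rewrite [X in _ + X]big_nat_cond [X in _ + X]big1 ?addr0; last first.
      by move=> i /andP[/andP[ni _] _]; rewrite ltnNge ni /= scale0r.
    rewrite big_nat_cond [RHS]big_nat_cond; apply: eq_bigr => i /andP[/andP[_ ->] _].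
    by [].
  have spanS x : in_span A x -> S x.
    elim=> {x} [|x y _ [n [c ->]] _ [m [c' ->]]|a x _ [n [c ->]]|p].
    - by exists 0%N, (fun=> 0); rewrite big_geq.
    - exists (n + m)%N, (fun i => (if (i < n)%N then c i else 0) +
                                  (if (i < m)%N then c' i else 0)).
      rewrite (pad n m) (pad m n) (addnC m n) -big_split.
      by apply: eq_bigr => i _; rewrite scalerDl.
    - exists n, (fun i => a * c i); rewrite scaler_sumr.
      by apply: eq_bigr => i _; rewrite scalerA.
    - have [->|Ap] := eqVneq (A p) 0.
        by exists 0%N, (fun=> 0); rewrite big_geq.
      have [i Ii <-] := nu_surj p Ap.
      exists i.+1, (fun j => (j == i)%:R).
      rewrite big_mkcond (bigD1_seq i) ?mem_index_iota ?iota_uniq//=.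
      rewrite mem_set// eqxx scale1r big1 ?addr0// => j /negbTE ->.
      by rewrite scale0r if_same.
  move=> O [x Ox] oO.
  have /nbhs_ballP[eps /= eps0 xO] : nbhs x O by exact: open_nbhs_nbhs.
  have [y /spanS Sy xy] := Adense x eps eps0.
  by exists y; split=> //; apply: xO; rewrite -ball_normE.
apply: (@le_lt_trans _ _ C%:E); last exact: ltry.
(* [mu] inverts [nu] on its image, so that a choice of points per index becomes a choice per
   pair. *)
have [mu hmu] : exists mu : nat * nat -> nat, forall m, I m -> mu (nu m) = m.
  have pick p : exists m, (exists2 m', I m' & nu m' = p) -> I m /\ nu m = p.
    have [[m Im mp]|no] := pselect (exists2 m', I m' & nu m' = p); first by exists m.
    by exists 0%N.
  have [mu h] := choice pick; exists mu => m Im.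
  have [Imu E] := h (nu m) (ex_intro2 _ _ m Im erefl).
  by apply: nu_inj E; rewrite inE.
apply: lime_le.
  apply: is_cvg_nneseries => m _ _; apply: ereal_sup_ge.
  exists ((dot (rho 0) (A (nu m))) ^+ 2)%:E; first by exists 0.
  by rewrite lee_fin sqr_ge0.
apply: nearW => n; rewrite -big_filter.
apply: (@sum_ereal_sup_le _ _ 0 _ _ (fun m u => dot (rho u) ((A \o nu) m) ^+ 2)).
- by rewrite filter_uniq// iota_uniq.
- by move=> i u; exact: sqr_ge0.
move=> v; set s := [seq _ <- _ | _].
have sI m : m \in s -> I m by rewrite mem_filter => /andP[/set_mem].
have us : uniq [seq nu m | m <- s].
  rewrite map_inj_in_uniq ?filter_uniq ?iota_uniq// => i j /sI Ii /sI Ij E.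
  by apply: nu_inj E; rewrite inE.
have := AC _ (fun p => v (mu p)) us; rewrite big_map.
by rewrite (eq_big_seq (fun m => dot (rho (v m)) ((A \o nu) m) ^+ 2))// => m /sI /hmu ->.
Qed.

End Compress.

(** * Completion to a basis of the whole space *)

Section SpanRepresents.
Context (R : realType) (H : completeNormedModType R).
Context (d : nat) (rho : 'rV[R]_d -> H).
Context (disp : measure_display) (T : measurableType disp) (P : probability T R).
Context (zeta : 'rV[R]_d -> {RV P >-> R}).

Lemma span_represents (v : nat -> 'rV[R]_d) x :
  in_span (fun n => rho (v n)) x -> exists X, represents rho zeta X x.
Proof.
elim=> {x} [|x y _ [X hX] _ [Y hY]|c x _ [X hX]|n].
- by exists (fun=> 0); exact: represents0.
- by eexists; exact: representsD hX hY.
- by eexists; exact: representsZ hX.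
- by eexists; exact: represents_field.
Qed.

End SpanRepresents.

Theorem theorem2p4 (R : realType) (H : completeNormedModType R)
  (dot : {dot H for idfun}) (hdot : induces_norm dot) (hsep : separable H)
  (d : nat) (hd : (1 <= d)%N) (rho : 'rV[R]_d -> H)
  (disp : measure_display) (T : measurableType disp) (P : probability T R)
  (zeta : 'rV[R]_d -> {RV P >-> R})
  (hgauss : gaussian_field zeta) (hcentered : centered_field zeta)
  (hcov : forall u v, ('E_P[zeta u \* zeta v] = (dot (rho u) (rho v))%:E)%E)
  (zetac : 'rV[R]_d -> {RV P >-> R})
  (hmod : modification zeta zetac) (hcont : continuous_paths zetac)
  (hlim : {ae P, forall w, exists l : R,
             zetac u w @[u --> @norm_infty R d] --> l}) :
  exists (I : set nat) (e : nat -> H),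
    orthonormal_basis dot I e /\
    (\sum_(0 <= m <oo | m \in I)
       ereal_sup [set ((dot (rho u) (e m)) ^+ 2)%:E | u in [set: 'rV[R]_d]]
     < +oo)%E.
Proof.
have osc := fun e0 delta => @net_oscillation _ _ _ _ _ _ _ hmod hcont hlim e0 delta hd.
have [v hv] := separable_range 0 rho hsep.
(* Starting from values of [rho] makes each [e n] a finite combination of such values, hence
   represented by a Gaussian variable. *)
have [e [eON ev ve]] := gram_schmidt hdot (fun n => rho (v n)).
have [g ge] := choice (fun n => span_represents zeta (ev n)).
have [w [B [wON we ew wB [C BC]]]] := rows_exist hdot hgauss hcentered hcov osc eON ge.
have [x hx] := separable_dense_seq hsep.
have [p hp] := choice (fun n => projection hdot eON (x n)).
(* The residuals of a dense sequence are dense in the orthogonal complement of the closed span of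
   [rho], which [f] therefore exhausts. *)
have [f [fON fz zf]] := gram_schmidt hdot (fun n => x n - p n).
have ef j n : dot (f n) (e j) = 0.
  by apply: in_span_orthogonal (fz n) => m; exact: (hp m).2.
have rho_f u n : dot (rho u) (f n) = 0.
  apply/eqP; rewrite -normr_le0; apply/ler_addgt0Pr => eps eps0; rewrite add0r.
  have [i hi] := hv u eps eps0.
  have : dot (rho (v i)) (f n) = 0.
    by apply: in_span_orthogonal (ve i) => j; rewrite dotC ef.
  move=> /(congr1 (fun t => dot (rho u) (f n) - t)); rewrite subr0 -dotBl => <-.
  exact: le_trans (normr_dot_le hdot fON _ _) (ltW hi).
(* The complement becomes row 0, at no cost since every [rho u] is orthogonal to [f]. *)
pose W k := if k is l.+1 then w l else f.
pose BW k : R := if k is l.+1 then B l else 0.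
apply: (@compress _ _ _ _ rho (pairs W) C).
- apply: rows_orthonormal => [[|k] |[|k] [|l] i j] //=.
  + split=> [i j ij|i]; last exact: (wON.2 (k, i)).
    by apply: (wON.1 (k, i) (k, j)) => -[].
  + move=> _; rewrite dotC; apply: in_span_orthogonal (we l j) => m.
    by rewrite dotC ef.
  + move=> kl; apply: (wON.1 (k, i) (l, j)) => -[kl' _].
    by move: kl; rewrite kl' ltnn.
- move=> y eps eps0; have eps20 : 0 < eps / 2 by rewrite divr_gt0.
  have [n yn] := hx y _ eps20; have [m pm] := (hp n).1 _ eps20.
  (* [y] is close to [x n], which is [p n] plus its residual, and [p n] is close to a partial
     projection. *)
  exists (partial_proj dot e m (x n) + (x n - p n)).
    apply: in_spanD.
      apply: in_span_sum => j _; apply: in_spanZ.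
      by apply: in_span_trans (ew j) => -[k i]; exact: (in_span_gen (pairs W) (k.+1, i)).
    by apply: in_span_trans (zf n) => i; exact: (in_span_gen (pairs W) (0%N, i)).
  have -> : y - (partial_proj dot e m (x n) + (x n - p n)) =
      (y - x n) + (p n - partial_proj dot e m (x n)).
    by rewrite opprD opprB (addrC (- partial_proj _ _ _ _)) -addrA (addrCA (p n)) !addrA.
  by rewrite (le_lt_trans (ler_normD _ _))// [eps]splitr ltrD.
- apply: (@pairs_sum_le _ _ _ _ _ W BW).
  + case=> [|k]; last exact: wB.
    by move=> u m; rewrite big1// => i _; rewrite rho_f expr0n.
  + case=> [|M]; first by rewrite big_ord0; have := BC 0%N; rewrite big_ord0.
    by rewrite big_ord_recl add0r; exact: BC.
Qed.
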